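(* Let $F\in\mathbb{D}$ and let $f:\mathbb{R}\to\mathbb{R}$ be Lipschitz and of class $C^1$ such that $f'$ is Lipschitz continuous. Then for every $k\in\mathbb{N}$, $$D_kf(F) = f'(F)\,D_kF + R_k ,$$ where the remainder term $R_k$ satisfies $$|R_k| \le \frac{\|f''\|_\infty}{2\sqrt{p_kq_k}}\,|D_kF|^2 .$$
   Context: Setting: $\mathbb{N}=\{1,2,\dots\}$. $(X_k)_{k\in\mathbb{N}}$ is a sequence of independent random variables with $P(X_k=1)=p_k$, $P(X_k=-1)=q_k$, where $p_k\in(0,1)$ and $q_k=1-p_k$ (non-symmetric, non-homogeneous Rademacher sequence). The normalised sequence is $Y_k=(X_k-p_k+q_k)/(2\sqrt{p_kq_k})$. $\mathscr{G}$ is the $\sigma$-algebra generated by $(Y_k)$, and $L^2(\Omega)=L^2(\Omega,\mathscr{G},P)$. Multiple integrals: $\mathfrak{H}=\ell^2(\mathbb{N})$, $\mathfrak{H}^{\otimes n}=\ell^2(\mathbb{N}^n)$, $\Delta_n=\{(i_1,\dots,i_n)\in\mathbb{N}^n: i_k\ne i_j \text{ for } k\neq j\}$, and $\mathfrak{H}_0^{\odot n}$ is the set of symmetric $f\in\mathfrak{H}^{\otimes n}$ vanishing off $\Delta_n$ (with $\mathfrak{H}_0^{\odot 0}=\mathbb{R}$). For $f\in\mathfrak{H}_0^{\odot n}$, $n\ge1$, $J_n(f)=\sum_{(i_1,\dots,i_n)\in\Delta_n}f(i_1,\dots,i_n)Y_{i_1}\cdots Y_{i_n}$ (in $L^2(\Omega)$),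 and $J_0(c)=c$ for $c\in\mathbb{R}$. Every $F\in L^2(\Omega)$ has a decomposition $F=E[F]+\sum_{n\ge1}J_n(f_n)$ with $f_n\in\mathfrak{H}_0^{\odot n}$. Discrete Malliavin derivative: $\mathbb{D}$ is the set of $F=E[F]+\sum_{n\ge1}J_n(f_n)\in L^2(\Omega)$ with $\sum_{n\ge1}n\,n!\,\|f_n\|^2_{\mathfrak{H}^{\otimes n}}<\infty$; for such $F$, $D_kF=\sum_{n\ge1}nJ_{n-1}(f_n(\cdot,k))$, $k\in\mathbb{N}$. If $F\in\mathbb{D}$ and $f$ is Lipschitz then $f(F)\in\mathbb{D}$, so $D_kf(F)$ is defined. $\|f''\|_\infty$ denotes the essential supremum of the a.e.-defined derivative of $f'$, i.e. the Lipschitz constant of $f'$. Identities and inequalities between random variables hold almost surely. *)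

(* Defs.v *)
From HB Require Import structures.
From mathcomp Require Import all_boot all_order all_algebra perm finmap.
From mathcomp Require Import all_classical all_reals all_analysis.
From mathcomp Require Import ess_sup_inf summability.

Set Implicit Arguments.
Unset Strict Implicit.
Unset Printing Implicit Defensive.

Import Order.TTheory GRing.Theory Num.Theory.
Import numFieldNormedType.Exports.

Local Open Scope classical_set_scope.
Local Open Scope ring_scope.

(* The index set {1, 2, ...} is relabelled as nat, so Y_1 is Y 0, etc. *)

Definition mutually_independent (R : realType) (d : measure_display)
    (T : measurableType d) (P : probability T R) (X : nat -> {RV P >-> R}) : Prop :=
  forall (J : {fset nat}) (B : nat -> set R),
    (forall i, measurable (B i)) ->
    P (\bigcap_(i in [set` J]) (X i @^-1` B i)) =
    (\big[mule/1]_(i <- J) P (X i @^-1` B i))%E.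

Definition normalised (R : realType) (d : measure_display)
    (T : measurableType d) (P : probability T R) (p q : nat -> R)
    (X : nat -> {RV P >-> R}) (k : nat) (w : T) : R :=
  (X k w - p k + q k) / (2 * Num.sqrt (p k * q k)).

(* A generating family of the sigma-algebra of the sequence Y; the
   sigma-algebra itself is <<s cylinders Y>>. *)
Definition cylinders (R : realType) (T : Type) (Y : nat -> T -> R) :
    set (set T) :=
  \bigcup_k preimage_set_system setT (Y k) measurable.

Section Chaos.
Context (R : realType) (d : measure_display) (T : measurableType d).
Context (P : probability T R) (Y : nat -> T -> R).

(* L^2(Omega, sigma(Y), P), as a set of functions (not of classes). *)
Definition L2_sigma : set (T -> R) :=
  [set F | measurable_fun [set: g_sigma_algebraType (cylinders Y)] F /\
           F \in Lfun P 2%:E].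

Definition is_L2_lim (I : Type) (Phi : set_system I) (u : I -> T -> R)
    (G : T -> R) : Prop :=
  L2_sigma G /\
  (Lnorm P 2%:E (EFin \o (u i \- G)) @[i --> Phi] --> 0%E).

Definition Delta (n : nat) : set (n.-tuple nat) := [set i | uniq i].

Definition sqnorm (n : nat) (f : n.-tuple nat -> R) : \bar R :=
  \esum_(i in [set: n.-tuple nat]) ((f i) ^+ 2)%:E.

(* For n = 0 this is R: there is exactly one 0-tuple and Delta 0 contains it. *)
Definition H0sym (n : nat) : set (n.-tuple nat -> R) :=
  [set f | [/\ (sqnorm f < +oo)%E,
               (forall (s : 'S_n) (i : n.-tuple nat),
                  f [tuple tnth i (s j) | j < n] = f i) &
               (forall i, ~ Delta i -> f i = 0)]].

(* The L^2 limit of the sums over finite sets A of indices in Delta n, along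
   the filter of all finite sets ordered by inclusion (one representative of
   its class; cst 0 if there is no limit). *)
Definition J (n : nat) (f : n.-tuple nat -> R) : T -> R :=
  xget (cst 0) [set G | is_L2_lim totally
    (fun (A : {fset n.-tuple nat}) w =>
       \sum_(i <- A | i \in Delta (n:=n)) f i * \prod_(j < n) Y (tnth i j) w) G].

(* The kernel f 0 plays no role. *)
Definition chaos_decomposition (F : T -> R) (f : forall n, n.-tuple nat -> R) :
    Prop :=
  (forall n, (0 < n)%N -> H0sym (f n)) /\
  is_L2_lim \oo
    (fun N w => fine 'E_P[F] + \sum_(1 <= n < N) J (f n) w) F.

Definition malliavin_kernels (F : T -> R) (f : forall n, n.-tuple nat -> R) :
    Prop :=
  chaos_decomposition F f /\
  (\sum_(1 <= n <oo) ((n * n`!)%:R)%:E * sqnorm (f n) < +oo)%E.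

Definition malliavin_domain : set (T -> R) :=
  [set F | exists f, malliavin_kernels F f].

(* f(., k) *)
Definition last_section (n : nat) (f : n.+1.-tuple nat -> R) (k : nat) :
    n.-tuple nat -> R :=
  fun i => f [tuple of rcons i k].

(* A representative of D_k F; cst 0 if F is not in the domain.  The sum over
   n >= 1 is indexed by m = n - 1. *)
Definition D (k : nat) (F : T -> R) : T -> R :=
  xget (cst 0) [set G | exists f, malliavin_kernels F f /\
    is_L2_lim \oo
      (fun N w => \sum_(0 <= m < N)
         m.+1%:R * J (last_section (f m.+1) k) w) G].

End Chaos.

(* ||f''||_oo.  The value of derive1 g at a point where g is not derivable is
   unspecified; for Lipschitz g = f' these points form a null set. *)
Definition second_derivative_norm (R : realType) (f : R -> R) : \bar R :=
  ess_sup lebesgue_measure (fun x : R => (`|derive1 (derive1 f) x|)%:E).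

(* Main.v *)
From HB Require Import structures.
Require Import Defs.
From mathcomp Require Import all_boot all_order all_algebra perm finmap.
From mathcomp Require Import all_classical all_reals all_analysis.
From mathcomp Require Import measurable_realfun ess_sup_inf summability.
From mathcomp Require Import ring lra.

(** Each Y_k takes two values y+ and y-, with y+ - y- = 1/sqrt(p_k q_k).
    Freezing the other coordinates, F = A + B Y_k where A and B do not depend
    on the k-th sign; then B = D_k F, and the same reading of f(F) gives D_k
    f(F) = sqrt(p_k q_k) (f(A + B y+) - f(A + B y-)). On the event Y_k = y+ the
    first argument is F and the second is F - D_k F / sqrt(p_k q_k); on Y_k =
    y- the second is F and the first is F + D_k F / sqrt(p_k q_k). So, up to
    sign, R_k is sqrt(p_k q_k) times the remainder of a first-order Taylor
    expansion of f at F with increment h = -D_k F / sqrt(p_k q_k) or its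
    opposite, and |f(F + h) - f(F) - f'(F) h| <= ||f''|| h^2 / 2 is exactly the
    claim.

    D_k is defined through chaos expansions, and the decomposition F = A + B
    Y_k has to be recovered from them. The products W_S of the Y_i over the
    finite sets S of indices are orthonormal (dot_walsh) and total in L2 of the
    sigma-algebra of Y (walsh_complete), so by Riesz-Fischer and Parseval
    (riesz_fischer, parseval) a random variable is read from its coefficients
    on the W_S. An ordered tuple of distinct indices contributes to W_S for S
    its set of entries; hence the coefficient of J_n(f_n) at S is the sum of
    f_n over the orderings of S (J_wcoef), the domain of D is described by the
    finiteness of the sum of |S| times the squared coefficients
    (malliavin_domainP), and D_k acts by moving the coefficient at S + k to S,
    for k outside S, and killing the other ones (D_wcoef).

    The formula for D_k f(F) is a statement about coefficients too. For a finite
    combination of the W_S it is an averaging over the k-th sign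
    (finite_bit_difference_is_gradient); since f is Lipschitz and, for fixed
    k, D_k is continuous in L2, it passes to the limit
    (bit_difference_is_gradient). It also shows |D_k f(F)| <= K |D_k F|,
    whence f(F) is in the domain of D (lipschitz_malliavin_domain).

    The norm of f'' is an essential supremum of an almost everywhere
    derivative. That it bounds the Lipschitz constant of f' is the fact that a
    Lipschitz function is the integral of its derivative, obtained here from
    the Radon-Nikodym theorem and Lebesgue differentiation
    (lipschitz_bound_of_ae_derive). *)

Set Implicit Arguments.
Unset Strict Implicit.
Unset Printing Implicit Defensive.

Import Order.TTheory GRing.Theory Num.Theory.
Import numFieldNormedType.Exports.

Local Open Scope classical_set_scope.
Local Open Scope ring_scope.

(** * Lipschitz functions and their almost everywhere derivative *)

Section LipschitzDerivative.
Context {R : realType}.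
Local Notation mu := (@lebesgue_measure R).

Lemma contraction_right_continuous (u : R -> R) :
  (forall x y, `|u x - u y| <= `|x - y|) -> right_continuous u.
Proof.
move=> hu; apply: right_continuousW => x.
apply/cvgrPdist_lt => e e0; near=> y.
rewrite (le_lt_trans (hu _ _))//.
Unshelve. all: by end_near. Qed.

Section Density.
Variable u : R -> R.
Hypothesis (u_nd : {homo u : x y / x <= y}).
Hypothesis (u_le : forall x y, x <= y -> u y - u x <= y - x).

Lemma u_dist x y : `|u x - u y| <= `|x - y|.
Proof.
wlog xy : x y / y <= x => [hw|].
  by case/orP: (le_total x y) => ?; [rewrite distrC (distrC x)|]; exact: hw.
by rewrite !ger0_norm ?subr_ge0// ?u_le// u_nd.
Qed.

(** The complement of u: when u has slopes in [0, 1] both u and this function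
    are nondecreasing, and their Stieltjes measures add up to Lebesgue measure. *)
Definition id_minus (x : R) := x - u x.

Lemma id_minus_nd : {homo id_minus : x y / x <= y}.
Proof. by move=> x y xy; rewrite /id_minus; have := u_le xy; lra. Qed.

Lemma id_minus_dist x y : `|id_minus x - id_minus y| <= `|x - y|.
Proof.
wlog xy : x y / y <= x => [hw|].
  by case/orP: (le_total x y) => ?; [rewrite distrC (distrC x)|]; exact: hw.
rewrite !ger0_norm ?subr_ge0// ?id_minus_nd// /id_minus.
by have := u_nd xy; lra.
Qed.

HB.instance Definition _ := isCumulative.Build R _ R u u_nd
  (contraction_right_continuous u_dist).
HB.instance Definition _ := isCumulative.Build R _ R id_minus id_minus_nd
  (contraction_right_continuous id_minus_dist).

Local Notation nu := (lebesgue_stieltjes_measure u).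
Local Notation nu' := (lebesgue_stieltjes_measure id_minus).

Lemma LS_ocitv (f : cumulative R R) (a b : R) : a <= b ->
  lebesgue_stieltjes_measure f `]a, b] = (f b - f a)%:E.
Proof.
move=> ab; rewrite /lebesgue_stieltjes_measure /measure_extension.
rewrite measurable_mu_extE/=; last exact: is_ocitv.
by rewrite wlength_itv_bnd.
Qed.

(** The measures of u and of id - u have sum Lebesgue measure, because this
    holds on half-open intervals. *)
Lemma LS_le_lebesgue A : measurable A -> (nu A <= mu A)%E.
Proof.
move=> mA; rewrite (@lebesgue_measure_unique _ (measure_add nu nu'))//.
  by rewrite [leRHS]measure_addE leeDl.
move=> X /ocitvP[->|[[a b] /= ab ->]]; first by rewrite !measure0.
rewrite [RHS]measure_addE.
rewrite [RHS](_ : _ = (u b - u a)%:E + (id_minus b - id_minus a)%:E)%E;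
  last first.
  by congr (_ + _)%E; apply: LS_ocitv; exact: ltW.
rewrite lebesgue_measure_itv/= lte_fin ab.
by rewrite /id_minus -!EFinD; congr EFin; lra.
Qed.

(** The Stieltjes measure of u is dominated by Lebesgue measure, so
    Radon-Nikodym gives its density; the restriction to ]a, b] makes it a
    finite measure. *)
Lemma nondecreasing_contraction_density (a b : R) : a < b ->
  exists r : R -> R, [/\ forall x, 0 <= r x, mu.-integrable setT (EFin \o r) &
   forall x, a <= x <= b -> (\int[mu]_(t in `]a, x]) (r t)%:E =
     (u x - u a)%:E)%E].
Proof.
move=> ab; have mab : measurable (`]a, b] : set (measurableTypeR R))
  by exact: measurable_itv.
have fin : (nu `]a, b] < +oo)%E by rewrite LS_ocitv ?ltry// ltW.
have [] := @radon_nikodym_sigma_finite _ _ R mu (mfrestr mab fin).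
  apply/null_content_dominatesP => A mA A0.
  apply/eqP; rewrite eq_le measure_ge0 andbT -A0 /mfrestr /mrestr.
  by apply: le_trans (LS_le_lebesgue _) _;
    [exact: measurableI|apply: le_measure; rewrite ?inE//; exact: measurableI].
move=> f [f0 ffin fint fE].
have frE : EFin \o (fine \o f) = f by apply/funext => x /=; rewrite fineK.
exists (fine \o f); split => [x||x /andP[ax xb]]; first exact: fine_ge0.
  by rewrite frE.
have -> : (\int[mu]_(t in `]a, x]) ((fine \o f) t)%:E = \int[mu]_(t in `]a, x])
  f t)%E.
  by apply: eq_integral => t _; rewrite /= fineK.
rewrite -fE//; transitivity (nu (`]a, x] `&` `]a, b])) => //.
rewrite setIidl ?LS_ocitv//.
by apply: subset_itvl; rewrite bnd_simp.
Qed.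

(** By Lebesgue differentiation the density of u is almost everywhere its
    derivative, so u b - u a is the integral of a function bounded by M. The
    bound is asked for only where u is derivable since the density exhibits
    such points almost everywhere. *)
Lemma le_slope_of_ae_derive (a b M : R) : a < b -> 0 <= M ->
  {ae mu, forall x, derivable u x 1 -> derive1 u x <= M} ->
  u b - u a <= M * (b - a).
Proof.
move=> ab M0 uM; have [r [r0 ri rE]] := nondecreasing_contraction_density ab.
have rM : {ae mu, forall x, x \in `]a, b[ -> r x <= M}.
  have rS y : mu.-integrable [set` Interval (BRight a) (BRight y)] (EFin \o r).
    apply: (integrableS measurableT) => //; exact: measurable_itv.
  have := FTC1 rS (open_integrable_locally openT ri).
  apply: (@filterS2 _ _ (ae_filter_ringOfSetsType mu) _ _ _ _ uM) => x {}uM;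
    move=> FT; rewrite in_itv/= => /andP[ax xb].
  have [dF <-] := FT ax.
  set F := fun y : R => _ in dF *.
  have FE : \forall y \near x, F y = u y - u a.
    near=> y; rewrite /F /Rintegral rE//; apply/andP; split; apply/ltW; near: y.
      exact: lt_nbhsr.
    exact: lt_nbhsl.
  have FuE : \near x, (F + cst (u a)) x = u x.
    by near=> y; have /= FEy := near FE y;
      rewrite -[LHS]/(F y + u a) FEy ?subrK.
  have dF' : is_derive x 1 (F + cst (u a)) (derive1 F x + 0).
    by apply: is_deriveD; rewrite derive1E; exact: derivableP.
  have [du] := near_eq_is_derive FuE dF'.
  rewrite addr0 => <-; rewrite -derive1E; exact: uM.
rewrite -lee_fin -rE; last by rewrite lexx (ltW ab).
have -> : (M * (b - a))%:E = (\int[mu]_(t in `]a, b]) (cst M%:E) t)%E.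
  by rewrite integral_cst//= lebesgue_measure_itv/= lte_fin ab -EFinB.
rewrite -(@integral_itv_bndo_bndc _ _ _ (EFin \o r)); last first.
  by apply: measurable_funS (measurable_int _ ri).
rewrite -(@integral_itv_bndo_bndc _ _ _ (cst M%:E))//.
apply: ae_ge0_le_integral => //=.
- by move=> x _; rewrite lee_fin.
- by apply: measurable_funS (measurable_int _ ri).
Unshelve. all: by end_near. Qed.

End Density.

(** Adding K x to a K-Lipschitz function makes it nondecreasing with slopes at
    most 2 K; after division by 2 K, le_slope_of_ae_derive applies. *)
Lemma lipschitz_slope_le (g : R -> R) (K M a b : R) : 0 < K -> 0 <= M ->
  (forall x y, `|g x - g y| <= K * `|x - y|) ->
  {ae mu, forall x, derivable g x 1 -> derive1 g x <= M} ->
  a < b -> g b - g a <= M * (b - a).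
Proof.
move=> K0 M0 gK gM ab; have K2 : (2 * K)^-1 > 0 by rewrite invr_gt0; lra.
pose u x := (2 * K)^-1 * (g x + K * x).
have gE : g = (2 * K) *: u - K *: id.
  by apply/funext => x /=; rewrite /u /=;
    change (g x = (2 * K) * ((2 * K)^-1 * (g x + K * x)) - K * x); field; lra.
have und : {homo u : x y / x <= y}.
  move=> x y xy; rewrite /u ler_pM2l//; have := gK x y.
  by rewrite ler_norml distrC (@ger0_norm _ (y - x)) ?subr_ge0// => /andP[_];
    lra.
have ule x y : x <= y -> u y - u x <= y - x.
  move=> xy; rewrite /u -mulrBr -ler_pdivlMl// invrK; have := gK y x.
  by rewrite ler_norml (@ger0_norm _ (y - x)) ?subr_ge0// => /andP[_]; lra.
have := @le_slope_of_ae_derive u und ule a b ((2 * K)^-1 * (M + K)) ab.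
have -> : 0 <= (2 * K)^-1 * (M + K) by rewrite mulr_ge0//; lra.
move=> /(_ erefl); rewrite {1 2}/u -mulrBr -mulrA ler_pM2l//.
suff h : {ae mu, forall x, derivable u x 1 -> derive1 u x <=
  (2 * K)^-1 * (M + K)}.
  by move=> /(_ h); lra.
apply: (@filterS _ _ (ae_filter_ringOfSetsType mu) _ _ _ gM) => x {}gM du.
have dK : is_derive x 1 (K *: id : R -> R) (K *: (1 : R)) by exact: is_deriveZ.
have du' : is_derive x 1 u (derive1 u x) by rewrite derive1E; exact: derivableP.
have dg : is_derive x 1 g ((2 * K) *: derive1 u x - K *: (1 : R)).
  by rewrite gE; exact: is_deriveB.
have [dg1 dg2] := dg; move: (gM dg1); rewrite derive1E dg2 /GRing.scale/= => h.
by rewrite mulrC ler_pdivlMr; lra.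
Qed.

(** An essential bound on the derivative of a Lipschitz function is a Lipschitz
    constant: the one-sided slope bound is used for g and for - g. *)
Lemma lipschitz_bound_of_ae_derive (g : R -> R) (K M : R) :
  (forall x y, `|g x - g y| <= K * `|x - y|) ->
  {ae mu, forall x, `|derive1 g x| <= M} ->
  forall x y, `|g x - g y| <= M * `|x - y|.
Proof.
move=> gK gM x y.
have M0 : 0 <= M.
  (* The bound holds at some point, since the line is not negligible. *)
  have mu0 : (0 < mu setT)%E.
    by rewrite -set_itvNyy lebesgue_measure_itv/= ltry.
  have [z] := @filter_ex _ _ (ae_properfilter_algebraOfSetsType mu0) _ gM.
  exact: le_trans.
have K0 : 0 < `|K| + 1 by rewrite ltr_wpDl.
have {}gK z t : `|g z - g t| <= (`|K| + 1) * `|z - t|.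
  by apply: le_trans (gK z t) _; rewrite ler_wpM2r// ler_wpDr// ler_norm.
wlog xy : x y / y <= x => [hw|].
  by case/orP: (le_total x y) => ?; [rewrite distrC (distrC x)|]; exact: hw.
have [->|yx0] := eqVneq y x; first by rewrite !subrr normr0 mulr0.
have yx : y < x by rewrite lt_neqAle yx0.
rewrite (@ger0_norm _ (x - y)) ?subr_ge0// ler_norml; apply/andP; split.
  suff : - g x - - g y <= M * (x - y) by lra.
  apply: (@lipschitz_slope_le (fun x => - g x) _ M y x K0 M0) => //.
    by move=> z t; rewrite -opprD normrN.
  apply: (@filterS _ _ (ae_filter_ringOfSetsType mu) _ _ _ gM) => z {}gM dg.
  have dg' : derivable g z 1.
    by have := derivableN dg; rewrite (_ : - _ = g)//; apply/funext => t /=;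
      rewrite -[LHS]/(- - g t) opprK.
  rewrite derive1E (deriveN dg') -derive1E; move: gM;
    rewrite ler_norml => /andP[]; lra.
apply: (lipschitz_slope_le K0 M0 gK _ yx).
apply: (@filterS _ _ (ae_filter_ringOfSetsType mu) _ _ _ gM) => z {}gM dg.
by apply: le_trans gM; rewrite ler_norm.
Qed.

End LipschitzDerivative.

(** * The second-order Taylor bound *)

Section SecondOrder.
Context {R : realType}.
Local Notation mu := (@lebesgue_measure R).

(** Subtract from f its tangent at x and the parabola M (t - x)^2 / 2: the
    difference has derivative of sign opposite to t - x, hence its maximum is
    at x. *)
Lemma taylor1_le (f : R -> R) (M : R) (f_der : forall x : R, derivable f x 1) :
  (forall x y, `|derive1 f x - derive1 f y| <= M * `|x - y|) ->
  forall x y, f y - f x - derive1 f x * (y - x) <= M / 2 * (y - x) ^+ 2.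
Proof.
move=> fM x y.
pose phi : R -> R := f - (cst (derive1 f x) * (id - cst x))
  - (cst (M / 2) * (id - cst x) ^+ 2).
have phiE t : phi t = f t - derive1 f x * (t - x) - M / 2 * (t - x) ^+ 2.
  by rewrite /phi /= !fctE.
have dphi (t : R) : is_derive t 1 phi (derive1 f t - derive1 f x - M * (t - x)).
  have df : is_derive t 1 f (derive1 f t) by rewrite derive1E;
    exact: derivableP.
  apply: is_derive_eq; rewrite /= !fctE /GRing.scale /=.
  by field.
have phi1 (t : R) : derivable phi t 1 by case: (dphi t).
have phi2 t : derive1 phi t = derive1 f t - derive1 f x - M * (t - x).
  by rewrite derive1E; case: (dphi t).
have phic : continuous phi.
  by move=> t; apply: differentiable_continuous; apply/derivable1_diffP.
suff : phi y <= phi x by rewrite !phiE subrr; lra.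
have [xy|yx] := leP x y.
- apply: (@ler0_derive1_le_cc _ phi x y) => //.
  + move=> t; rewrite in_itv/= => /andP[xt ty]; rewrite phi2.
    have := fM t x; rewrite (@ger0_norm _ (t - x)) ?subr_ge0 ?(ltW xt)//
      ler_norml => /andP[]; lra.
  + by apply: continuous_subspaceT; exact: phic.
  + by rewrite in_itv/= lexx xy.
  + by rewrite in_itv/= lexx.
- apply: (@ger0_derive1_le_cc _ phi y x) => //; [|..|exact: ltW].
  + move=> t; rewrite in_itv/= => /andP[xt ty]; rewrite phi2.
    have := fM t x; rewrite (@ler0_norm _ (t - x)) ?subr_le0 ?(ltW ty)//
      ler_norml => /andP[]; lra.
  + by apply: continuous_subspaceT; exact: phic.
  + by rewrite in_itv/= lexx (ltW yx).
  + by rewrite in_itv/= lexx (ltW yx).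
Qed.

Lemma taylor1_abs (f : R -> R) (M : R) (f_der : forall x : R, derivable f x 1) :
  (forall x y, `|derive1 f x - derive1 f y| <= M * `|x - y|) ->
  forall x y, `|f y - f x - derive1 f x * (y - x)| <= M / 2 * (y - x) ^+ 2.
Proof.
move=> fM x y; rewrite ler_norml taylor1_le// andbT lerNl.
have dN (t : R) : derive1 (- f) t = - derive1 f t by rewrite !derive1E deriveN.
have fN (t : R) : derivable (- f) t 1 by exact: derivableN.
have := @taylor1_le (- f) M fN _ x y.
rewrite dN opprD -/(- f) => h.
have : (- f) y - (- f) x - - derive1 f x * (y - x) <= M / 2 * (y - x) ^+ 2.
  by apply: h => z t; rewrite !dN -opprD normrN fM.
by rewrite -[(- f) y]/(- f y) -[(- f) x]/(- f x); lra.
Qed.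

Lemma lipschitz_constant (f : R -> R) : lipschitz f ->
  exists2 K, 0 < K & forall x y, `|f x - f y| <= K * `|x - y|.
Proof.
move=> /pinfty_ex_gt0[K K0 h]; exists K => // x y.
exact: (h (x, y) (conj I I)).
Qed.

(** The extended-real form covers a norm that is not known beforehand to be
    finite: an infinite norm makes the bound trivial unless y = x, where both
    sides vanish. *)
Lemma second_derivative_remainder (f : R -> R)
    (f_der : forall x : R, derivable f x 1) (f'_lip : lipschitz (derive1 f))
    (x y : R) :
  (`|f y - f x - derive1 f x * (y - x)|%:E <=
    second_derivative_norm f * (2^-1 * (y - x) ^+ 2)%:E)%E.
Proof.
have [->|yx] := eqVneq y x.
  by rewrite !subrr mulr0 subrr normr0 expr0n/= mulr0 mule0.
have h0 : 0 < 2^-1 * (y - x) ^+ 2.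
  by rewrite mulr_gt0 ?invr_gt0// exprn_even_gt0//= subr_eq0.
have mu0 : (0 < mu setT)%E by rewrite -set_itvNyy lebesgue_measure_itv/= ltry.
have N0 : (0 <= second_derivative_norm f)%E.
  apply: ess_sup_gee => //.
  by apply: (@filterE _ _ (ae_filter_ringOfSetsType mu)) => t; rewrite lee_fin.
have := ess_sup_ge mu (fun x : R => (`|derive1 (derive1 f) x|)%:E).
rewrite -/(second_derivative_norm f).
case: (second_derivative_norm f) N0 => [M||] // M0 hM; last first.
  by rewrite gt0_mulye ?lte_fin// leey.
have [K _ fK] := lipschitz_constant f'_lip.
have fM := lipschitz_bound_of_ae_derive fK hM.
by rewrite -EFinM lee_fin mulrA; exact: taylor1_abs.
Qed.

End SecondOrder.

(** * Square-integrable functions *)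

Section L2Space.
Context {R : realType} {d : measure_display} {T : measurableType d}.
Variable P : probability T R.
Implicit Types u v : T -> R.

Local Notation L2 := (Lfun P 2%:E).

Lemma LnormE2 u : Lnorm P 2%:E (EFin \o u) =
  ((\int[P]_w (u w ^+ 2)%:E) `^ 2^-1)%E.
Proof.
rewrite unlock; congr (_ `^ _)%E; apply: eq_integral => w _ /=.
by rewrite powR_mulrn// real_normK// num_real.
Qed.

Lemma L2P u : (u \in L2) <->
  measurable_fun setT u /\ (\int[P]_w (u w ^+ 2)%:E < +oo)%E.
Proof.
split.
  move=> uL; split.
    by move: uL; rewrite inE => /andP[]; rewrite inE.
  move/Lfun2_integrable_sqr: uL => /integrableP[_].
  by under eq_integral do rewrite /= ger0_norm ?sqr_ge0//.
move=> [mu fu]; rewrite inE; apply/andP; split; rewrite inE//=.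
by rewrite /finite_norm LnormE2 poweR_lty.
Qed.

Lemma L2_measurable u : u \in L2 -> measurable_fun setT u.
Proof. by move=> /L2P[]. Qed.

Lemma L2_mulr_integrable u v : u \in L2 -> v \in L2 ->
  P.-integrable setT (fun w => (u w * v w)%:E).
Proof. by move=> uL vL; apply/Lfun1_integrable/Lfun2_mul_Lfun1. Qed.

Lemma measurable_sqr u : measurable_fun setT u ->
  measurable_fun setT (fun w => (u w ^+ 2)%:E).
Proof. by move=> mu; apply/measurable_EFinP; exact: measurable_funX. Qed.

(** The criterion of square-integrability for products with bounded variables
    and for images under Lipschitz functions. *)
Lemma L2_dom (c : R) u v : measurable_fun setT u -> v \in L2 ->
  {ae P, forall w, `|u w| <= c * `|v w|} -> u \in L2.
Proof.
move=> mu vL uv; apply/L2P; split=> //.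
have [mv fv] := (L2P v).1 vL.
apply: (@le_lt_trans _ _ (\int[P]_w ((c ^+ 2)%:E * (v w ^+ 2)%:E))%E).
  apply: ae_ge0_le_integral => //.
  - by move=> w _; rewrite lee_fin sqr_ge0.
  - exact: measurable_sqr.
  - by move=> w _; rewrite -EFinM lee_fin mulr_ge0 ?sqr_ge0.
  - by apply: emeasurable_funM => //; exact: measurable_sqr.
  apply: filterS uv => w uv _; rewrite -EFinM lee_fin -exprMn.
  rewrite -[u w ^+ 2]real_normK ?num_real// -[leRHS]real_normK ?num_real//.
  rewrite lerXn2r ?nnegrE//; apply: le_trans uv _.
  by rewrite normrM ler_wpM2r// ler_norm.
rewrite ge0_integralZl//; last 3 first.
- exact: measurable_sqr.
- by move=> w _; rewrite lee_fin sqr_ge0.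
- by rewrite lee_fin sqr_ge0.
by rewrite lte_mul_pinfty// lee_fin sqr_ge0.
Qed.

Lemma L2_cst c : cst c \in L2.
Proof. exact: Lfun_cst. Qed.

Lemma L2_bounded (c : R) u : measurable_fun setT u ->
  {ae P, forall w, `|u w| <= c} -> u \in L2.
Proof.
move=> mu uc; apply: (@L2_dom c u (cst 1)) => //; first exact: L2_cst.
by apply: filterS uc => w; rewrite normr1 mulr1.
Qed.

Lemma L2D u v : u \in L2 -> v \in L2 -> (u \+ v) \in L2.
Proof. by move=> uL vL; have [_] := @Lfun_addr_closed _ T R P 2%:E (lee1n 2);
  exact. Qed.

Lemma L2Z c u : u \in L2 -> (fun w => c * u w) \in L2.
Proof.
move=> uL; apply: (@L2_dom `|c| _ u) => //.
  by apply: measurable_funM => //; exact: L2_measurable.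
by apply: nearW => w; rewrite normrM.
Qed.

Lemma L2B u v : u \in L2 -> v \in L2 -> (u \- v) \in L2.
Proof.
move=> uL vL; rewrite (_ : _ \- _ = u \+ (fun w => -1 * v w)).
  by apply: L2D => //; exact: L2Z.
by apply/funext => w /=; rewrite mulN1r.
Qed.

Lemma L2_sum (I : Type) (r : seq I) (Q : pred I) (F : I -> T -> R) :
  (forall i, Q i -> F i \in L2) -> (fun w => \sum_(i <- r | Q i) F i w) \in L2.
Proof.
move=> FL; elim: r => [|i r IH].
  by under eq_fun do rewrite big_nil; exact: L2_cst.
under eq_fun do rewrite big_cons.
by case: (boolP (Q i)) => // Qi; apply: L2D => //; exact: FL.
Qed.

Lemma L2_integrable u : u \in L2 -> P.-integrable setT (EFin \o u).
Proof.
move=> uL; have := L2_mulr_integrable uL (L2_cst 1).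
by apply: eq_integrable => // w _; rewrite /= mulr1.
Qed.

(** The inner product of L2 as a real number; it is meaningful for
    square-integrable arguments only. *)
Definition dot u v : R := \int[P]_w (u w * v w).

Lemma dotC u v : dot u v = dot v u.
Proof. by apply: eq_Rintegral => w _; rewrite mulrC. Qed.

Lemma dotDl u v z : u \in L2 -> v \in L2 -> z \in L2 ->
  dot (u \+ v) z = dot u z + dot v z.
Proof.
move=> uL vL zL; rewrite /dot -RintegralD//; last 2 first.
- exact: L2_mulr_integrable.
- exact: L2_mulr_integrable.
by apply: eq_Rintegral => w _ /=; rewrite mulrDl.
Qed.

Lemma dotZl c u z : u \in L2 -> z \in L2 ->
  dot (fun w => c * u w) z = c * dot u z.
Proof.
move=> uL zL; rewrite /dot -RintegralZl//; last exact: L2_mulr_integrable.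
by apply: eq_Rintegral => w _ /=; rewrite mulrA.
Qed.

Lemma dotBl u v z : u \in L2 -> v \in L2 -> z \in L2 ->
  dot (u \- v) z = dot u z - dot v z.
Proof.
move=> uL vL zL; rewrite /dot -RintegralB//; last 2 first.
- exact: L2_mulr_integrable.
- exact: L2_mulr_integrable.
by apply: eq_Rintegral => w _ /=; rewrite mulrBl.
Qed.

Lemma dotDr u v z : u \in L2 -> v \in L2 -> z \in L2 ->
  dot z (u \+ v) = dot z u + dot z v.
Proof. by move=> *; rewrite dotC dotDl// !(dotC z). Qed.

Lemma dotZr c u z : u \in L2 -> z \in L2 ->
  dot z (fun w => c * u w) = c * dot z u.
Proof. by move=> *; rewrite dotC dotZl// (dotC z). Qed.

Lemma dotBr u v z : u \in L2 -> v \in L2 -> z \in L2 ->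
  dot z (u \- v) = dot z u - dot z v.
Proof. by move=> *; rewrite dotC dotBl// !(dotC z). Qed.

Lemma dot_suml (I : Type) (r : seq I) (Q : pred I) (F : I -> T -> R) z :
  (forall i, Q i -> F i \in L2) -> z \in L2 ->
  dot (fun w => \sum_(i <- r | Q i) F i w) z = \sum_(i <- r | Q i) dot (F i) z.
Proof.
move=> FL zL; elim: r => [|i r IH].
  rewrite big_nil /dot; under eq_Rintegral do rewrite big_nil mul0r.
  by rewrite /Rintegral integral0.
rewrite big_cons; under [in LHS]eq_fun do rewrite big_cons.
case: (boolP (Q i)) => // Qi; rewrite -IH dotDl//; first exact: FL.
exact: L2_sum.
Qed.

Lemma dot_ge0 u : 0 <= dot u u.
Proof. by apply: Rintegral_ge0 => w _; rewrite -expr2 sqr_ge0. Qed.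

Lemma integral_sqr u : u \in L2 -> (\int[P]_w (u w ^+ 2)%:E = (dot u u)%:E)%E.
Proof.
move=> uL; rewrite /dot /Rintegral fineK//.
exact/integrable_fin_num/L2_mulr_integrable.
Qed.

Lemma dot_ae u v u' v' : u \in L2 -> v \in L2 -> u' \in L2 -> v' \in L2 ->
  {ae P, forall w, u w * v w = u' w * v' w} -> dot u v = dot u' v'.
Proof.
move=> uL vL uL' vL' uv; rewrite /dot /Rintegral; congr fine.
apply: ae_eq_integral => //.
- exact/measurable_int/L2_mulr_integrable.
- exact/measurable_int/L2_mulr_integrable.
by apply: filterS uv => w -> _.
Qed.

Lemma dot_le u v (c : R) : 0 <= c -> u \in L2 -> v \in L2 ->
  {ae P, forall w, `|u w| <= c * `|v w|} -> dot u u <= c ^+ 2 * dot v v.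
Proof.
move=> c0 uL vL uv.
have cvL : (fun w => c * v w) \in L2 by exact: L2Z.
have -> : c ^+ 2 * dot v v = dot (fun w => c * v w) (fun w => c * v w).
  by rewrite dotZl// dotC dotZl// mulrA.
rewrite -lee_fin -!integral_sqr//; apply: ae_ge0_le_integral => //.
- by move=> w _; rewrite lee_fin sqr_ge0.
- exact/measurable_sqr/L2_measurable.
- by move=> w _; rewrite lee_fin sqr_ge0.
- exact/measurable_sqr/L2_measurable.
apply: filterS uv => w uv _; rewrite lee_fin.
rewrite -[u w ^+ 2]real_normK ?num_real// -[leRHS]real_normK ?num_real//.
by rewrite lerXn2r ?nnegrE// normrM (ger0_norm c0).
Qed.

Lemma cauchy_schwarz u v : u \in L2 -> v \in L2 ->
  dot u v ^+ 2 <= dot u u * dot v v.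
Proof.
move=> uL vL.
(* The squared norm of u - t v. *)
have q (t : R) : 0 <= dot u u - 2 * t * dot u v + t ^+ 2 * dot v v.
  have tvL : (fun w => t * v w) \in L2 by exact: L2Z.
  have := dot_ge0 (u \- (fun w => t * v w)).
  rewrite dotBl ?dotBr//; last exact: L2B.
  rewrite !dotZl ?dotZr// (dotC v u); lra.
have [v0|v0] := eqVneq (dot v v) 0.
  rewrite v0 mulr0; move: q; rewrite v0 => q.
  have [->|uv0] := eqVneq (dot u v) 0; first by rewrite expr0n.
  (* A choice of t that makes the affine function of t equal to -1. *)
  have := q ((dot u u + 1) / (2 * dot u v)).
  rewrite mulr0 addr0 (_ : 2 * _ * _ = dot u u + 1); first lra.
  by field.
have vp : 0 < dot v v by rewrite lt_neqAle eq_sym v0 dot_ge0.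
have := q (dot u v / dot v v).
rewrite (_ : _ + _ = (dot u u * dot v v - dot u v ^+ 2) / dot v v);
  last by field.
by rewrite pmulr_lge0 ?invr_gt0// subr_ge0.
Qed.

Lemma dotD_le u v : u \in L2 -> v \in L2 ->
  dot (u \+ v) (u \+ v) <= 2 * (dot u u + dot v v).
Proof.
move=> uL vL; have := dot_ge0 (u \- v).
have uvL := L2D uL vL; have uvL' := L2B uL vL.
rewrite dotBl// !dotBr// dotDl// !dotDr// (dotC v u); lra.
Qed.

Lemma LnormE2_dot u : u \in L2 ->
  Lnorm P 2%:E (EFin \o u) = (Num.sqrt (dot u u))%:E.
Proof.
by move=> uL; rewrite LnormE2 integral_sqr// poweR_EFin powR12_sqrt ?dot_ge0.
Qed.

(** Convergence in the L2 norm is handled through squared norms, which avoids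
    extended reals and square roots. *)
Lemma Lnorm_cvg0 (I : Type) (Phi : set_system I) {FF : Filter Phi}
    (u : I -> T -> R) : (forall i, u i \in L2) ->
  (Lnorm P 2%:E (EFin \o u i) @[i --> Phi] --> 0%E) <->
  (dot (u i) (u i) @[i --> Phi] --> (0 : R)).
Proof.
move=> uL.
have -> : (fun i => Lnorm P 2%:E (EFin \o u i)) =
   EFin \o (fun i => Num.sqrt (dot (u i) (u i))).
  by apply/funext => i; rewrite /= LnormE2_dot.
split.
  move=> /fine_cvgP[_ h0].
  have h : Num.sqrt (dot (u i) (u i)) @[i --> Phi] --> (0 : R) := h0.
  have -> : (fun i => dot (u i) (u i)) =
      (fun i => Num.sqrt (dot (u i) (u i)) * Num.sqrt (dot (u i) (u i))).
    by apply/funext => i; rewrite -expr2 sqr_sqrtr ?dot_ge0.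
  by rewrite -[X in _ --> X](mulr0 0); exact: cvgM.
move=> h; apply: cvg_EFin; first exact: nearW.
rewrite /comp/= -(@sqrtr0 R).
by apply: continuous_cvg => //; exact: sqrt_continuous.
Qed.

Lemma dot_cvgl (I : Type) (Phi : set_system I) {FF : Filter Phi}
    (u : I -> T -> R) g v : (forall i, u i \in L2) -> g \in L2 -> v \in L2 ->
  dot (u i \- g) (u i \- g) @[i --> Phi] --> (0 : R) ->
  dot (u i) v @[i --> Phi] --> dot g v.
Proof.
move=> uL gL vL ug; apply: cvg_zero.
have -> : (fun i => dot (u i) v) - cst (dot g v) = (fun i => dot (u i \- g) v).
  by apply/funext => i; rewrite dotBl.
have h : Num.sqrt (dot (u i \- g) (u i \- g) * dot v v) @[i --> Phi] -->
  (0 : R).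
  rewrite -(@sqrtr0 R) -[X in Num.sqrt X](mul0r (dot v v)).
  apply: continuous_cvg; first exact: sqrt_continuous.
  by apply: cvgM ug _; exact: cvg_cst.
have hN : - Num.sqrt (dot (u i \- g) (u i \- g) * dot v v) @[i --> Phi] -->
  (0 : R).
  by rewrite -[X in _ --> X]oppr0; exact: cvgN.
apply: (squeeze_cvgr _ hN h); apply: nearW => i.
rewrite -ler_norml -sqrtr_sqr ler_wsqrtr//.
by apply: cauchy_schwarz => //; exact: L2B.
Qed.

Lemma dot_cvg_self (I : Type) (Phi : set_system I) {FF : Filter Phi}
    (u : I -> T -> R) g : (forall i, u i \in L2) -> g \in L2 ->
  dot (u i \- g) (u i \- g) @[i --> Phi] --> (0 : R) ->
  dot (u i) (u i) @[i --> Phi] --> dot g g.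
Proof.
move=> uL gL ug.
have -> : (fun i => dot (u i) (u i)) =
    (fun i => dot (u i \- g) (u i \- g) + (2 * dot (u i) g - dot g g)).
  apply/funext => i; rewrite dotBl//; last exact: L2B.
  by rewrite !dotBr// (dotC g (u i)); ring.
rewrite -[X in _ --> X]add0r; apply: cvgD => //.
rewrite [X in _ --> X](_ : _ = 2 * dot g g - dot g g); last by ring.
apply: cvgB; last exact: cvg_cst.
by apply: cvgM; [exact: cvg_cst|exact: dot_cvgl].
Qed.

End L2Space.

(** * Completeness of L2 over a generated sigma-algebra *)

Section Completeness.
Context {R : realType} {d : measure_display} {T : measurableType d}.
Variables (P : probability T R) (C : set (set T)).
Hypothesis C_measurable : C `<=` measurable.

Local Notation L2 := (Lfun P 2%:E).
Local Notation measC u := (measurable_fun [set: g_sigma_algebraType C] u).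

Lemma g_sigma_measurable (A : set T) : <<s C >> A -> measurable A.
Proof. exact: (smallest_sub (sigma_algebra_measurable T)). Qed.

Lemma g_sigma_measurable_fun (u : T -> R) : measC u -> measurable_fun setT u.
Proof.
move=> mu _ B mB; have := mu measurableT B mB.
exact: g_sigma_measurable.
Qed.

Lemma geometric_sum_lty : (\sum_(n <oo) ((2^-1 : R) ^+ n)%:E < +oo)%E.
Proof.
apply: le_lt_trans (ltry 2); apply: lime_le.
  by apply: is_cvg_nneseries => n _ _; rewrite lee_fin exprn_ge0.
apply: nearW => n; rewrite sumEFin lee_fin.
suff -> : \sum_(0 <= i < n) (2^-1 : R) ^+ i = 2 - 2 * 2^-1 ^+ n.
  by rewrite lerBlDr lerDl mulr_ge0// exprn_ge0.
elim: n => [|n IH]; first by rewrite big_nil expr0; lra.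
by rewrite big_nat_recr//= IH exprS; lra.
Qed.

(** Cauchy-Schwarz against the constant 1. *)
Lemma integral_norm_le u (c : R) : 0 <= c -> u \in L2 -> dot P u u <= c ^+ 2 ->
  (\int[P]_w `|(u w)%:E| <= c%:E)%E.
Proof.
move=> c0 uL uc; pose v w := `|u w|.
have vL : v \in L2.
  apply: (@L2_dom _ _ _ P 1 v u) => //.
    by apply: measurableT_comp => //; exact: L2_measurable uL.
  by apply: nearW => w; rewrite normr_id mul1r.
have oneL : cst 1 \in L2 by exact: L2_cst.
have -> : (\int[P]_w `|(u w)%:E| = (dot P v (cst 1))%:E)%E.
  rewrite /dot /Rintegral fineK;
    last exact/integrable_fin_num/L2_mulr_integrable.
  by apply: eq_integral => w _; rewrite /= mulr1.
rewrite lee_fin; have h := cauchy_schwarz vL oneL.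
have h1 : dot P (cst 1) (cst 1) = 1.
  rewrite /dot; under eq_Rintegral do rewrite /= mulr1.
  by rewrite Rintegral_cst// mul1r -[RHS]/(fine 1%E); congr fine;
    exact: probability_setT.
have hv : dot P v v = dot P u u.
  by apply: eq_Rintegral => w _; rewrite /v -expr2 real_normK ?num_real// expr2.
rewrite -(ler_pXn2r (n := 2))// ?nnegrE.
- by apply: le_trans h _; rewrite h1 hv mulr1.
- by apply: Rintegral_ge0 => w _; rewrite /= mulr1 /v.
Qed.

Variable u : nat -> T -> R.
Hypotheses (um : forall n, measC (u n)) (uL : forall n, u n \in L2).
Hypothesis u_fast :
  forall n m, (n <= m)%N -> dot P (u m \- u n) (u m \- u n) <= 2^-1 ^+ n ^+ 2.

Let G (w : T) : R := fine (limn_esup (fun n => (u n w)%:E)).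

(** The increments u (n + 1) - u n have L1 norms with finite sum, so their
    absolute values are summable almost everywhere and the sequence converges
    there. *)
Lemma fast_cauchy_ae_cvg : {ae P, forall w, u n w @[n --> \oo] --> G w}.
Proof.
pose v n := u n.+1 \- u n.
have vL n : v n \in L2 by exact: L2B.
have mv n : measurable_fun setT (fun w => `|(v n w)%:E|%E).
  by apply: measurableT_comp => //; apply/measurable_EFinP;
    exact: L2_measurable (vL n).
have fin : (\int[P]_w (\sum_(n <oo) `|(v n w)%:E|) < +oo)%E.
  rewrite integral_nneseries//; apply: le_lt_trans geometric_sum_lty.
  apply: lee_nneseries => [n _ _|n _].
    by apply: integral_ge0.
  apply: integral_norm_le => //.
  exact: u_fast.
have int : P.-integrable setT (fun w => \sum_(n <oo) `|(v n w)%:E|)%E.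
  apply/integrableP; split.
    by apply: ge0_emeasurable_sum => // n w _ _; exact: abse_ge0.
  rewrite (le_lt_trans _ fin)// ge0_le_integral//.
  - apply: measurableT_comp => //.
    by apply: ge0_emeasurable_sum => // n w _ _; exact: abse_ge0.
  - by apply: ge0_emeasurable_sum => // n w _ _; exact: abse_ge0.
  - by move=> w _; rewrite gee0_abs//; exact: nneseries_ge0.
apply: filterS (integrable_ae measurableT int) => w /(_ I) wfin.
suff h : cvgn (u ^~ w).
  have hE : (u n w)%:E @[n --> \oo] --> (limn (u ^~ w))%:E
    by apply: cvg_EFin => //; exact: nearW.
  by rewrite /G (cvg_limn_einf_sup hE).2 /=.
have -> : u ^~ w = (fun n => u 0%N w + series (v ^~ w) n).
  by apply/funext => n; rewrite (eq_sum_telescope (u ^~ w)).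
apply: is_cvgD; first exact: is_cvg_cst.
apply: normed_cvg.
apply: nondecreasing_is_cvgn.
  by apply: nondecreasing_series => n _ _; exact: normr_ge0.
exists (fine (\sum_(n <oo) `|(v n w)%:E|)%E) => _ [n _ <-].
rewrite -lee_fin fineK// /series /= -sumEFin.
by apply: nneseries_lim_ge => i _ _.
Qed.

(** Completeness is needed inside a sub-sigma-algebra: the pointwise limit is
    taken as an upper limit, which is measurable for the sigma-algebra that
    makes the u n measurable, and Fatou's lemma turns the Cauchy rate into a
    rate of convergence. *)
Lemma fast_cauchy_lim : exists g, [/\ measC g, g \in L2 &
  forall n, dot P (u n \- g) (u n \- g) <= 2^-1 ^+ n ^+ 2].
Proof.
have Gm : measC G.
  rewrite /G; apply: measurableT_comp; first exact: fine_measurable.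
  by apply: measurable_fun_limn_esup => n; apply/measurable_EFinP; exact: um.
have GmT := g_sigma_measurable_fun Gm.
have mdiff n : measurable_fun setT (u n \- G).
  by apply: measurable_funB => //; exact: L2_measurable (uL n).
have bound n : (\int[P]_w ((u n w - G w) ^+ 2)%:E <= (2^-1 ^+ n ^+ 2)%:E)%E.
  pose f m w := ((u n w - u (n + m)%N w) ^+ 2)%:E.
  have mf m : measurable_fun setT (f m).
    by apply: measurable_sqr; apply: measurable_funB;
      exact: L2_measurable (uL _).
  have f0 m w : setT w -> (0 <= f m w)%E by rewrite lee_fin sqr_ge0.
  have -> : (\int[P]_w ((u n w - G w) ^+ 2)%:E =
    \int[P]_w limn_einf (f ^~ w))%E.
    apply: ge0_ae_eq_integral => //.
    - exact: (measurable_sqr (mdiff n)).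
    - by apply: measurableT_comp => //; apply: measurable_fun_limn_esup => m;
      exact: measurableT_comp.
    - by move=> w _; rewrite lee_fin sqr_ge0.
    - move=> w _; rewrite limn_einf_lim; apply: lime_ge;
      first exact: is_cvg_einfs.
      apply: nearW => m; apply: le_ereal_inf_tmp => _ [k _ <-]; exact: f0.
    apply: filterS fast_cauchy_ae_cvg => w hw _.
    apply/esym; apply: (cvg_limn_einf_sup _).1.
    apply: cvg_EFin; first exact: nearW.
    have hs : u (n + m)%N w @[m --> \oo] --> G w.
      by under eq_fun do rewrite addnC; move: hw; rewrite -(cvg_shiftn n).
    have hB : u n w - u (n + m)%N w @[m --> \oo] --> u n w - G w.
      by apply: cvgB => //; exact: cvg_cst.
    by rewrite expr2; exact: (cvgM hB hB).
  apply: le_trans (@fatou _ _ _ P setT measurableT f mf f0) _.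
  rewrite limn_einf_lim; apply: lime_le; first exact: is_cvg_einfs.
  apply: nearW => m; apply: (@le_trans _ _ (\int[P]_w f m w)%E).
    by apply: ereal_inf_lbound; exists m => /=.
  rewrite /f integral_sqr; last exact: L2B.
  rewrite lee_fin; have <- : dot P (u (n + m)%N \- u n) (u (n + m)%N \- u n) =
      dot P (u n \- u (n + m)%N) (u n \- u (n + m)%N).
    by apply: eq_Rintegral => w _ /=; rewrite -mulrNN !opprB.
  by apply: u_fast; exact: leq_addr.
have dL n : (u n \- G) \in L2.
  by apply/L2P; split => //; apply: le_lt_trans (bound n) _; rewrite ltry.
exists G; split => //; last first.
  by move=> n; rewrite -lee_fin -integral_sqr//; exact: bound.
rewrite (_ : G = u 0%N \- (u 0%N \- G)); first exact: L2B.
by apply/funext => w /=; rewrite subKr.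
Qed.

End Completeness.

(** * Functions of finitely many signs *)

Section FiniteBits.
Context {R : realType}.
Implicit Types (phi : (nat -> bool) -> R) (e : nat -> bool).

Definition set_bit e (k : nat) (b : bool) : nat -> bool :=
  fun i => if i == k then b else e i.

Lemma set_bit_same e k b : set_bit e k b k = b.
Proof. by rewrite /set_bit eqxx. Qed.

Lemma set_bit_other e k b i : i != k -> set_bit e k b i = e i.
Proof. by rewrite /set_bit => /negbTE ->. Qed.

Lemma set_bit_id e k : set_bit e k (e k) = e.
Proof. by apply/funext => i; rewrite /set_bit; case: eqP => [->|]. Qed.

(** Such functions of the signs are the elementary random variables on which
    identities are checked before passing to the limit. *)
Definition depends_below (M : nat) phi :=
  forall e e', (forall i, (i < M)%N -> e i = e' i) -> phi e = phi e'.

Lemma depends_belowW M N phi : (M <= N)%N -> depends_below M phi ->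
    depends_below N phi.
Proof. by move=> MN h e e' ee; apply: h => i iM; apply: ee;
  exact: leq_trans MN. Qed.

Lemma depends_below_set_bit M phi b : depends_below M.+1 phi ->
  depends_below M (fun e => phi (set_bit e M b)).
Proof.
move=> h e e' ee; apply: h => i; rewrite ltnS leq_eqVlt /set_bit.
by case: eqP => //= _ /ee.
Qed.

Definition bit_prod (h : nat -> bool -> R) (S : {fset nat}) e : R :=
  \prod_(i <- S) h i (e i).

Lemma bit_prod0 h e : bit_prod h fset0 e = 1.
Proof. by rewrite /bit_prod big_seq_fset0. Qed.

Lemma bit_prod_rem h S k e : k \in S -> bit_prod h S e =
    h k (e k) * bit_prod h (S `\ k)%fset e.
Proof. by move=> kS; rewrite /bit_prod (big_fsetD1 k). Qed.

Lemma bit_prod_add h S k e : k \notin S -> bit_prod h (k |` S)%fset e =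
    h k (e k) * bit_prod h S e.
Proof. by move=> kS; rewrite /bit_prod big_fsetU1. Qed.

Lemma bit_prod_set_bit h S k b e : k \notin S -> bit_prod h S (set_bit e k b) =
    bit_prod h S e.
Proof.
move=> kS; rewrite /bit_prod !big_seq; apply: eq_bigr => i iS.
by rewrite set_bit_other//; apply: contraNneq kS => <-.
Qed.

Lemma depends_bit_prod h (S : {fset nat}) M : (forall i, i \in S -> (i < M)%N) ->
  depends_below M (bit_prod h S).
Proof.
move=> SM e e' ee; rewrite /bit_prod !big_seq; apply: eq_bigr => i iS.
by rewrite ee// SM.
Qed.

Lemma fset_nat_bound (S : {fset nat}) :
  exists M, forall i, i \in S -> (i < M)%N.
Proof.
exists (\max_(i <- S) i).+1 => i iS; rewrite ltnS.
by rewrite (big_fsetD1 i)//= leq_maxl.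
Qed.

(** Functions of finitely many signs are spanned by the products of the h i (e
    i), provided each h i separates the two signs. Interpolating phi linearly
    in h M (e M) writes it as a + b * h M (e M) with a and b depending on fewer
    coordinates, so induction moves the coordinates one at a time into S. It is
    used with the indicator of the sign 1, where independence applies directly,
    and with the values of Y_i, which yields Walsh products. *)
Lemma depends_below_ind (h : nat -> bool -> R)
    (K : ((nat -> bool) -> R) -> Prop) :
  (forall i, h i true != h i false) ->
  (forall phi psi, K phi -> K psi -> K (phi \+ psi)) ->
  (forall c phi, K phi -> K (fun e => c * phi e)) ->
  (forall S, K (bit_prod h S)) ->
  forall M phi, depends_below M phi -> K phi.
Proof.
move=> h10 KD KZ Kh M phi phiM.
suff H : forall S : {fset nat}, (forall i, i \in S -> (M <= i)%N) ->
    K (fun e => phi e * bit_prod h S e).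
  have := H fset0; rewrite (_ : (fun e => _) = phi); first by apply=> i;
    rewrite inE.
  by apply/funext => e; rewrite bit_prod0 mulr1.
elim: M phi phiM => [|M IH] phi phiM S SM.
  rewrite (_ : (fun e => _) = fun e => phi xpredT * bit_prod h S e);
    first exact: KZ.
  by apply/funext => e; congr (_ * _); exact: phiM.
have MS : M \notin S by apply/negP => /SM; rewrite ltnn.
(* phi e = a e + b e * h M (e M), with b the divided difference. *)
pose d := h M true - h M false.
have d0 : d != 0 by rewrite subr_eq0.
pose b e := (phi (set_bit e M true) - phi (set_bit e M false)) / d.
pose a e := phi (set_bit e M true) - b e * h M true.
have t := depends_below_set_bit true phiM;
  have f := depends_below_set_bit false phiM.
have bM : depends_below M b.
  by move=> e e' ee; rewrite /b; congr ((_ - _) / _); [exact: t|exact: f].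
have aM : depends_below M a.
  by move=> e e' ee; rewrite /a (bM _ _ ee); congr (_ - _); exact: t.
have -> : (fun e => phi e * bit_prod h S e) =
    (fun e => a e * bit_prod h S e) \+ (fun e => b e * bit_prod h (M |` S)%fset
      e).
  apply/funext => e /=; rewrite bit_prod_add// mulrA -mulrDl; congr (_ * _).
  have : phi e = phi (set_bit e M (e M)) by rewrite set_bit_id.
  case: (e M) => ->; rewrite /a /b; first by rewrite subrK.
  by rewrite /d; field; exact: d0.
apply: KD; apply: IH => //.
  by move=> i /SM /ltnW.
by move=> i; rewrite in_fset1U => /predU1P[->//|/SM /ltnW].
Qed.

End FiniteBits.

(** * Rademacher sequences *)

Section Bits.
Context {R : realType} {d : measure_display} {T : measurableType d}.
Context {P : probability T R} {p q : nat -> R} {X : nat -> {RV P >-> R}}.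

(** The standing hypotheses on the sequence X, bundled so that lemmas take one
    argument. *)
Record rademacher : Prop := Rademacher {
  rad_p : forall k, 0 < p k < 1 ;
  rad_q : forall k, q k = 1 - p k ;
  rad_X1 : forall k, P [set w | X k w = 1] = (p k)%:E ;
  rad_XN1 : forall k, P [set w | X k w = -1] = (q k)%:E ;
  rad_ind : mutually_independent X }.

Hypothesis H : rademacher.

Local Notation hp := (rad_p H).
Local Notation hq := (rad_q H).
Local Notation hX1 := (rad_X1 H).
Local Notation hXN1 := (rad_XN1 H).
Local Notation hind := (rad_ind H).
Local Notation L2 := (Lfun P 2%:E).
Local Notation Y := (normalised p q X).

Definition bits (w : T) : nat -> bool := fun i => X i w == 1.

Definition sqrt_pq (k : nat) : R := Num.sqrt (p k * q k).

(** The two values of Y_k. *)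
Definition Yval (k : nat) (b : bool) : R :=
  if b then q k / sqrt_pq k else - p k / sqrt_pq k.

Lemma p_gt0 k : 0 < p k. Proof. by case/andP: (hp k). Qed.
Lemma q_gt0 k : 0 < q k. Proof. by rewrite hq subr_gt0; case/andP: (hp k). Qed.
Lemma sqrt_pq_gt0 k : 0 < sqrt_pq k.
Proof. by rewrite sqrtr_gt0 mulr_gt0// ?p_gt0 ?q_gt0. Qed.
Lemma sqrt_pq_sqr k : sqrt_pq k ^+ 2 = p k * q k.
Proof. by rewrite sqr_sqrtr// mulr_ge0// ltW// ?p_gt0 ?q_gt0. Qed.
Lemma pq1 k : p k + q k = 1. Proof. by rewrite hq addrC subrK. Qed.

Lemma Yval_sep k : Yval k true != Yval k false.
Proof.
rewrite /Yval gt_eqF// mulNr; apply: (@lt_trans _ _ 0).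
  by rewrite oppr_lt0 divr_gt0// ?p_gt0 ?sqrt_pq_gt0.
by rewrite divr_gt0// ?q_gt0 ?sqrt_pq_gt0.
Qed.

Lemma Yval_mean k : p k * Yval k true + q k * Yval k false = 0.
Proof. by rewrite /Yval; ring. Qed.

Lemma Yval_var k : p k * Yval k true ^+ 2 + q k * Yval k false ^+ 2 = 1.
Proof.
have s0 := sqrt_pq_gt0 k; rewrite /Yval !exprMn sqrrN exprVn sqrt_pq_sqr.
have pk := p_gt0 k; have qk := q_gt0 k.
by rewrite -[RHS](pq1 k); field; rewrite !gt_eqF.
Qed.

Lemma measurable_Y k : measurable_fun setT (Y k).
Proof.
rewrite /normalised; apply: measurable_funM => //.
by apply: measurable_funD => //; apply: measurable_funB => //;
  exact: measurable_funP.
Qed.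

Lemma measurable_Xeq k (x : R) : measurable [set w | X k w = x].
Proof.
have mX : measurable_fun setT (X k) by [].
by have := mX measurableT _ (measurable_set1 x); rewrite setTI.
Qed.

(** Up to a null set every X k is 1 or -1, so all the Y k are functions of the
    sequence of signs. *)
Lemma Y_bits_ae : {ae P, forall w, forall k, Y k w = Yval k (bits w k)}.
Proof.
apply/ae_foralln => k.
have mA : measurable ([set w | X k w = 1] `|` [set w | X k w = -1]).
  by apply: measurableU; exact: measurable_Xeq.
exists (~` ([set w | X k w = 1] `|` [set w | X k w = -1])); split.
- exact: measurableC.
- apply: (etrans (probability_setC P mA)).
  rewrite measureU//; last 3 first.
  + exact: measurable_Xeq.
  + exact: measurable_Xeq.
  + by apply/seteqP; split => // w /= [->]; lra.
  transitivity (1 - ((p k)%:E + (q k)%:E))%E.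
    by congr (1 - (_ + _))%E; [exact: hX1|exact: hXN1].
  by rewrite -EFinD pq1 subrr.
move=> w /=; apply: contra_not => XX; rewrite /normalised /Yval /bits.
have s0 := sqrt_pq_gt0 k; rewrite -/(sqrt_pq k).
case: XX => /= ->; first by rewrite eqxx hq; field; lra.
rewrite (_ : (-1 == 1 :> R) = false); last by apply/eqP; lra.
by rewrite hq; field; lra.
Qed.

Lemma measurable_bit k : measurable_fun setT (fun w => (bits w k)%:R : R).
Proof.
rewrite (_ : (fun w => _) = \1_[set w | X k w = 1]).
  exact/measurable_indic/measurable_Xeq.
apply/funext => w; rewrite indicE /bits; congr ((nat_of_bool _)%:R).
by apply/idP/idP => [/eqP ?|]; [rewrite inE|rewrite inE => /eqP].
Qed.

Local Notation ones_prod := (bit_prod (fun _ b => b%:R : R)).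

Lemma ones_prod_E S w : ones_prod S (bits w) =
  (w \in \bigcap_(i in [set` S]) (X i @^-1` [set 1]))%:R.
Proof.
have [h|h] := boolP (w \in _).
  rewrite /bit_prod big_seq big1// => i iS; rewrite /bits.
  by move: h; rewrite inE => /(_ i iS) /= ->; rewrite eqxx.
have [i iS Xi] : exists2 i, i \in S & X i w != 1.
  apply: contrapT => HX; move/negP: h; apply; rewrite inE => i /= iS.
  by apply: contrapT => /eqP Xi; apply: HX; exists i.
by rewrite (bit_prod_rem _ _ iS) /bits (negbTE Xi) mul0r.
Qed.

Lemma measurable_ones_prod_set (S : {fset nat}) :
  measurable (\bigcap_(i in [set` S]) (X i @^-1` [set 1])).
Proof.
apply: bigcap_measurableType => i _; exact: measurable_Xeq.
Qed.

(** Independence enters only here. *)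
Lemma prob_ones_prod S :
  \int[P]_w ones_prod S (bits w) = \prod_(i <- S) p i.
Proof.
have -> : (fun w => ones_prod S (bits w)) =
    \1_(\bigcap_(i in [set` S]) (X i @^-1` [set 1])) :> (T -> R).
  by apply/funext => w; rewrite ones_prod_E indicE.
rewrite /Rintegral integral_indic//; last exact: measurable_ones_prod_set.
rewrite setIT; transitivity (fine (\big[mule/1]_(i <- S) (p i)%:E)%E).
  congr fine; apply: (etrans (hind S (B := fun=> [set 1])
    (fun=> measurable_set1 1))).
  by apply: eq_bigr => i _; exact: hX1.
by rewrite prodEFin.
Qed.

Lemma depends_bits_bounded M phi : depends_below M phi ->
  measurable_fun setT (fun w => phi (bits w) : R) /\
  exists c : R, forall e, `|phi e| <= c.
Proof.
pose K f := measurable_fun setT (fun w => f (bits w) : R) /\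
  exists c : R, forall e, `|f e| <= c.
rewrite -/(K phi); apply: (@depends_below_ind R (fun _ b => b%:R) K).
- by move=> i; rewrite eqr_nat.
- move=> f g [mf [c fc]] [mg [c' gc]]; split; first exact: measurable_funD.
  by exists (c + c') => e; rewrite (le_trans (ler_normD _ _))// lerD.
- move=> c f [mf [c' fc]]; split; first exact: measurable_funM.
  by exists (`|c| * c') => e; rewrite normrM ler_wpM2l.
- move=> S; split.
    by apply: measurable_prod => i _; exact: measurable_bit.
  exists 1 => e; rewrite /bit_prod; elim/big_rec: _ => [|i x _ x1];
    first by rewrite normr1.
  by rewrite normrM; case: (e i); rewrite ?normr1 ?mul1r// normr0 mul0r.
Qed.

Lemma depends_bits_L2 M phi : depends_below M phi ->
    (fun w => phi (bits w)) \in L2.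
Proof.
move=> /depends_bits_bounded[mphi [c phic]].
by apply: (@L2_bounded _ _ _ P c) => //; apply: nearW => w; exact: phic.
Qed.

Definition average_bit k phi (e : nat -> bool) : R :=
  p k * phi (set_bit e k true) + q k * phi (set_bit e k false).

Lemma depends_average_bit M k phi : depends_below M phi ->
    depends_below M (average_bit k phi).
Proof.
move=> h e e' ee; rewrite /average_bit; congr (_ * _ + _ * _); apply: h => i iM;
by rewrite /set_bit ee.
Qed.

(** The sign k is independent of the others, hence may be integrated first.
    Both sides are linear in phi, so it is enough to compare them on products
    of indicators of the sign 1. *)
Lemma integral_average_bit M k phi : depends_below M phi ->
  \int[P]_w phi (bits w) = \int[P]_w average_bit k phi (bits w).
Proof.
move=> phiM.
pose K f := (fun w => f (bits w)) \in L2 /\ (fun w => average_bit k f (bits w))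
  \in L2 /\
  \int[P]_w f (bits w) = \int[P]_w average_bit k f (bits w) :> R.
suff [_ [_]] : K phi by [].
apply: (@depends_below_ind R (fun _ b => b%:R) K) phiM => [i|f g|c f|S].
- by rewrite eqr_nat.
- move=> [fL [afL fE]] [gL [agL gE]].
  have aE w : average_bit k (f \+ g) (bits w) =
    average_bit k f (bits w) + average_bit k g (bits w).
    by rewrite /average_bit /=; ring.
  split; first exact: L2D.
  split; first by under eq_fun do rewrite aE; exact: L2D.
  under [RHS]eq_Rintegral do rewrite aE.
  rewrite RintegralD//; [|exact: L2_integrable..].
  by rewrite -fE -gE; apply: RintegralD => //; exact: L2_integrable.
- move=> [fL [afL fE]].
  have aE w : average_bit k (fun e => c * f e) (bits w) =
    c * average_bit k f (bits w).
    by rewrite /average_bit /=; ring.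
  split; first exact: L2Z.
  split; first by under eq_fun do rewrite aE; exact: L2Z.
  under [RHS]eq_Rintegral do rewrite aE.
  rewrite RintegralZl//; last exact: L2_integrable.
  by rewrite fE; apply/esym; apply: RintegralZl => //; exact: L2_integrable.
have [N SN] := fset_nat_bound S.
have dS : depends_below N (ones_prod S) by exact: depends_bit_prod.
split; first exact: depends_bits_L2 dS.
split; first exact: depends_bits_L2 (depends_average_bit k dS).
have [kS|kS] := boolP (k \in S); last first.
  by apply: eq_Rintegral => w _;
    rewrite /average_bit !bit_prod_set_bit// -mulrDl pq1 mul1r.
have aE w : average_bit k (ones_prod S) (bits w) =
  p k * ones_prod (S `\ k)%fset (bits w).
  have kSk : k \notin (S `\ k)%fset by rewrite !inE eqxx.
  by rewrite /average_bit !(bit_prod_rem _ _ kS) !set_bit_same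
    !bit_prod_set_bit// mul1r mul0r mulr0 addr0.
under [RHS]eq_Rintegral do rewrite aE.
rewrite RintegralZl//; last first.
  apply: L2_integrable; apply: (@depends_bits_L2 N);
    apply: depends_bit_prod => i.
  by rewrite !inE => /andP[_ /SN].
by rewrite !prob_ones_prod (big_fsetD1 k).
Qed.

End Bits.

Arguments rademacher {R d T P} p q X.
Arguments Yval {R} p q k b.
Arguments sqrt_pq {R} p q k.
Arguments average_bit {R} p q k phi e.
Arguments bits {R d T P} X w i.

(** * The Walsh system *)

Section Walsh.
Context {R : realType} {d : measure_display} {T : measurableType d}.
Context {P : probability T R} {p q : nat -> R} {X : nat -> {RV P >-> R}}.
Hypothesis H : rademacher p q X.

Local Notation L2 := (Lfun P 2%:E).
Local Notation Y := (normalised p q X).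
Local Notation L2S := (L2_sigma P Y).
Local Notation bits := (bits X).

Lemma cylinders_measurable : cylinders Y `<=` measurable.
Proof.
move=> A [k _ [B mB <-]]; exact: (measurable_Y k) measurableT _ mB.
Qed.

Lemma L2S_L2 u : L2S u -> u \in L2. Proof. by case. Qed.

Lemma Y_sigma_measurable k :
  measurable_fun [set: g_sigma_algebraType (cylinders Y)] (Y k).
Proof.
by move=> _ B mB; apply: sub_sigma_algebra; exists k => //; exists B.
Qed.

Lemma L2SD u v : L2S u -> L2S v -> L2S (u \+ v).
Proof. by move=> [mu uL] [mv vL]; split;
  [exact: measurable_funD|exact: L2D]. Qed.

Lemma L2SZ c u : L2S u -> L2S (fun w => c * u w).
Proof. by move=> [mu uL]; split; [exact: measurable_funM|exact: L2Z]. Qed.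

Lemma L2SB u v : L2S u -> L2S v -> L2S (u \- v).
Proof. by move=> [mu uL] [mv vL]; split;
  [exact: measurable_funB|exact: L2B]. Qed.

Lemma L2S_cst c : L2S (cst c).
Proof. by split => //; exact: L2_cst. Qed.

Lemma L2S_sum (I : Type) (r : seq I) (Q : pred I) (F : I -> T -> R) :
  (forall i, Q i -> L2S (F i)) -> L2S (fun w => \sum_(i <- r | Q i) F i w).
Proof.
move=> FL; elim: r => [|i r IH].
  by under eq_fun do rewrite big_nil; exact: L2S_cst.
under eq_fun do rewrite big_cons.
by case: (boolP (Q i)) => // Qi; apply: L2SD => //; exact: FL.
Qed.

Definition walsh (S : {fset nat}) (w : T) : R := \prod_(i <- S) Y i w.

Lemma walsh_bits : {ae P, forall w, forall S, walsh S w =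
    bit_prod (Yval p q) S (bits w)}.
Proof.
by apply: filterS (Y_bits_ae H) => w Yw S; apply: eq_bigr => i _; exact: Yw.
Qed.

Lemma bit_prod_Y_L2 S : (fun w => bit_prod (Yval p q) S (bits w)) \in L2.
Proof.
have [M SM] := fset_nat_bound S.
exact: (depends_bits_L2 (@depends_bit_prod _ _ _ _ SM)).
Qed.

Lemma L2S_walsh S : L2S (walsh S).
Proof.
have mW : measurable_fun [set: g_sigma_algebraType (cylinders Y)] (walsh S).
  by apply: measurable_prod => i _; exact: Y_sigma_measurable.
split=> //; apply: (@L2_dom _ _ _ P 1 _ _ _ (bit_prod_Y_L2 S)).
  exact (g_sigma_measurable_fun cylinders_measurable mW).
by apply: filterS walsh_bits => w ->; rewrite mul1r.
Qed.

Lemma walsh_L2 S : walsh S \in L2. Proof. exact: L2S_L2 (L2S_walsh S). Qed.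

Lemma dot_walsh_bits S S' : dot P (walsh S) (walsh S') =
  \int[P]_w (bit_prod (Yval p q) S (bits w) * bit_prod (Yval p q) S' (bits w)).
Proof.
have := @dot_ae _ _ _ P (walsh S) (walsh S') _ _ (walsh_L2 S) (walsh_L2 S')
  (bit_prod_Y_L2 S) (bit_prod_Y_L2 S').
by apply; apply: filterS walsh_bits => w Ww; rewrite !Ww.
Qed.

(** Averaging over the sign k, which occurs in one factor only, gives the mean
    of Y k, that is 0. *)
Lemma dot_walsh_neq S S' k : k \in S -> k \notin S' ->
    dot P (walsh S) (walsh S') = 0.
Proof.
move=> kS kS'; rewrite dot_walsh_bits.
have [M SM] := fset_nat_bound (S `|` S')%fset.
pose phi e := bit_prod (Yval p q) S e * bit_prod (Yval p q) S' e.
have phiM : depends_below M phi.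
  move=> e e' ee; rewrite /phi; congr (_ * _);
    apply: depends_bit_prod ee => i iS;
  by apply: SM; rewrite inE iS ?orbT.
rewrite (integral_average_bit H k phiM) (_ : (fun w => _) = cst 0); last first.
  apply/funext => w; rewrite /average_bit /phi !(bit_prod_rem _ _ kS)
    !set_bit_same.
  have kSk : k \notin (S `\ k)%fset by rewrite !inE eqxx.
  rewrite !bit_prod_set_bit//; set m := bit_prod _ _ _;
    set m' := bit_prod _ _ _.
  transitivity ((p k * Yval p q k true + q k * Yval p q k false) * (m * m')).
    by ring.
  by rewrite Yval_mean mul0r.
by rewrite /Rintegral integral0.
Qed.

(** Each factor Y k ^ 2 averages to the variance 1. *)
Lemma dot_walsh_self S : dot P (walsh S) (walsh S) = 1.
Proof.
rewrite dot_walsh_bits; elim/fset1U_rect: S => [|k S kS IH].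
  under eq_Rintegral do rewrite !bit_prod0 mulr1.
  rewrite Rintegral_cst// mul1r -[RHS]/(fine 1%E); congr fine.
  exact: probability_setT.
rewrite -[RHS]IH.
have [M SM] := fset_nat_bound (k |` S)%fset.
have phiM : depends_below M (fun e => bit_prod (Yval p q) (k |` S)%fset e
  * bit_prod (Yval p q) (k |` S)%fset e).
  by move=> e e' ee; congr (_ * _); apply: depends_bit_prod ee => i iS;
    exact: SM.
rewrite (integral_average_bit H k phiM); apply: eq_Rintegral => w _.
rewrite /average_bit !(bit_prod_add _ _ kS) !set_bit_same !bit_prod_set_bit//.
set m := bit_prod _ _ _; rewrite -[RHS]mul1r -(Yval_var H k); ring.
Qed.

Lemma dot_walsh S S' : dot P (walsh S) (walsh S') = (S == S')%:R.
Proof.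
have [->|SS'] := eqVneq; first exact: dot_walsh_self.
have [/fsubsetP sub|/fsubsetPn[k kS kS']] := boolP (S `<=` S')%fset; last first.
  exact: dot_walsh_neq kS kS'.
have [/fsubsetP sub'|/fsubsetPn[k kS' kS]] := boolP (S' `<=` S)%fset.
  case/eqP: SS'; apply/fsetP => i.
  by apply/idP/idP => [/sub|/sub'].
by rewrite dotC; exact: dot_walsh_neq kS' kS.
Qed.

Section WalshCompleteness.
Variable G : T -> R.
Hypotheses (GS : L2S G) (G0 : forall S, dot P G (walsh S) = 0).

(** Walsh products span the functions of finitely many signs. *)
Lemma dot_bits_eq0 M phi : depends_below M phi ->
    dot P G (fun w => phi (bits w)) = 0.
Proof.
move=> phiM.
pose K f := (fun w => f (bits w)) \in L2 /\ dot P G (fun w => f (bits w)) = 0.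
suff [] : K phi by [].
apply: (@depends_below_ind R (Yval p q) K) phiM => [i|f g|c f|S].
- exact: (Yval_sep H).
- move=> [fL f0] [gL g0]; split; first exact: L2D.
  by rewrite dotDr// ?f0 ?g0 ?addr0//; exact: L2S_L2.
- move=> [fL f0]; split; first exact: L2Z.
  by rewrite dotZr// ?f0 ?mulr0//; exact: L2S_L2.
split; first exact: bit_prod_Y_L2.
rewrite -[RHS](G0 S); apply: dot_ae; try exact: L2S_L2;
  try exact: bit_prod_Y_L2; try exact: walsh_L2.
by apply: filterS walsh_bits => w ->.
Qed.

(** A pi-system that contains the cylinders and on whose members the integral
    of G vanishes; the almost sure equality absorbs the null set where some X k
    is not a sign. *)
Definition bit_event : set (set T) := [set A | measurable A /\ exists M phi,
  depends_below M phi /\ {ae P, forall w, \1_A w = phi (bits w) :> R}].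

Lemma bit_event_setI : setI_closed bit_event.
Proof.
move=> A B [mA [M [f [fM fA]]]] [mB [N [g [gN gB]]]]; split;
  first exact: measurableI.
exists (maxn M N), (fun e => f e * g e); split.
  by move=> e e' ee; congr (_ * _);
    [apply: (depends_belowW (leq_maxl M N) fM)|apply:
    (depends_belowW (leq_maxr M N) gN)].
apply: filterS2 fA gB => w fA gB.
by rewrite -fA -gB indicI.
Qed.

Lemma cylinders_bit_event : cylinders Y `<=` bit_event.
Proof.
move=> A cA; split; first exact: cylinders_measurable.
case: cA => k _ [B mB <-]; exists k.+1, (fun e => (Yval p q k (e k) \in B)%:R);
  split.
  by move=> e e' -> .
by apply: filterS (Y_bits_ae H) => w Yw; rewrite indicE setTI -Yw;
  congr ((nat_of_bool _)%:R); apply/idP/idP; rewrite !inE.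
Qed.

Let intG : P.-integrable setT (EFin \o G).
Proof. by apply: L2_integrable; exact: L2S_L2. Qed.

(** Dynkin's theorem: the sets on which G integrates to 0 form a lambda-system
    containing the pi-system of events in finitely many signs. *)
Lemma integral_sigma_eq0 A : <<s cylinders Y >> A ->
    (\int[P]_(w in A) (G w)%:E = 0)%E.
Proof.
move=> cA.
pose Z := [set B : set T | measurable B /\ (\int[P]_(w in B) (G w)%:E = 0)%E].
have ZT : Z setT.
  split => //; have := dot_bits_eq0 (phi := cst 1) (M := 0) (fun _ _ _ =>
    erefl).
  rewrite /dot /Rintegral; under eq_integral do rewrite /= mulr1.
  by move=> h; rewrite -[LHS]fineK ?h//; exact: integrable_fin_num.
suff : <<s bit_event >> `<=` Z.
  by move=> /(_ A) []//; apply: sub_sigma_algebra2 cA;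
    exact: cylinders_bit_event.
apply: lambda_system_subset; [exact: bit_event_setI| | |by []].
- apply/dynkin_lambda_system; split => //.
  + move=> B [mB B0]; split; first exact: measurableC.
    have := ZT.2; rewrite -(setUv B) integral_setU ?B0 ?add0e//.
    * exact: measurableC.
    * by rewrite setUv; exact: measurable_int intG.
    * by apply/disj_setPS => w [].
  + move=> F tF Hm; have mF n : measurable (F n) by case: (Hm n).
    split; first exact: bigcup_measurable.
    rewrite integral_bigcup//; last by apply: integrableS intG => //;
      exact: bigcup_measurable.
    by rewrite eseries0// => n _ _; case: (Hm n).
- move=> B [mB [M [phi [phiM phiB]]]]; split => //.
  have h := dot_bits_eq0 phiM.
  have fin : (\int[P]_(w in B) (G w)%:E \is a fin_num)%E.
    by apply: integrable_fin_num => //; exact: integrableS intG.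
  rewrite -[LHS]fineK//; congr EFin.
  rewrite -[RHS]h -[LHS]/(\int[P]_(w in B) G w)%R Rintegral_mkcond /dot
    /Rintegral; congr fine.
  apply: ae_eq_integral => //.
  + apply/measurable_EFinP; apply/(measurable_restrictT _ _).1 => //.
    by apply: measurable_funS (L2_measurable (L2S_L2 GS)).
  + by apply: measurable_int (L2_mulr_integrable (L2S_L2 GS)
    (depends_bits_L2 phiM)).
  apply: filterS phiB => w hw _; rewrite -hw /patch indicE.
  by case: ifP; rewrite ?mulr1 ?mulr0.
Qed.

(** The integrals of G over the sets where G >= 0 and where G <= 0 vanish. *)
Lemma walsh_complete : {ae P, forall w, G w = 0}.
Proof.
have mG := GS.1.
have mGT : measurable_fun setT G by exact: L2_measurable (L2S_L2 GS).
have mEG D : measurable D -> measurable_fun D (EFin \o G).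
  by move=> mD; apply/measurable_EFinP; exact: measurable_funS mGT.
have spos : <<s cylinders Y >> (G @^-1` `[0, +oo[).
  by have := mG measurableT _ (measurable_itv `[0, +oo[); rewrite setTI.
have sneg : <<s cylinders Y >> (G @^-1` `]-oo, 0]).
  by have := mG measurableT _ (measurable_itv `]-oo, 0]); rewrite setTI.
have mpos := g_sigma_measurable cylinders_measurable spos.
have mneg := g_sigma_measurable cylinders_measurable sneg.
have aepos : ae_eq P (G @^-1` `[0, +oo[) (EFin \o G) (cst 0%E).
  apply/ae_eq_integral_abs => //; first exact: mEG.
  rewrite -[RHS](integral_sigma_eq0 spos); apply: eq_integral => w.
  by rewrite inE /= in_itv/= andbT => w0; rewrite ger0_norm.
have aeneg : ae_eq P (G @^-1` `]-oo, 0]) (EFin \o G) (cst 0%E).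
  apply/ae_eq_integral_abs => //; first exact: mEG.
  transitivity (\int[P]_(w in G @^-1` `]-oo, 0%R]) ((-1)%:E * (EFin \o G) w))%E.
    apply: eq_integral => w.
    by rewrite inE /= in_itv/= => w0; rewrite ler0_norm// -EFinM mulN1r.
  rewrite integralZl//; last exact: integrableS intG.
  by rewrite integral_sigma_eq0// mule0.
apply: filterS2 aepos aeneg => w /= hp hn.
have [w0|w0] := leP 0 (G w).
  by apply: EFin_inj; apply: hp; rewrite in_itv/= w0.
by apply: EFin_inj; apply: hn; rewrite in_itv/= ltW.
Qed.

End WalshCompleteness.
End Walsh.

Arguments walsh {R d T P} p q X S w.

(** * Riesz-Fischer and Parseval *)

Section EsumTail.
Context {R : realType} {I : choiceType}.
Implicit Types a b : I -> \bar R.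

Lemma fsum_le_esum (A : {fset I}) a : (forall i, 0 <= a i)%E ->
  (\sum_(i <- A) a i <= \esum_(i in setT) a i)%E.
Proof.
move=> a0; apply: esum_ge; exists [set` A]; first by split.
by rewrite fsbig_finite//= set_fsetK.
Qed.

(** Stated for all families b below a that vanish on A, so that it applies both
    to restrictions of a and to differences of coefficients. *)
Lemma esum_tail a (eps : R) : (forall i, 0 <= a i)%E ->
  (\esum_(i in setT) a i < +oo)%E -> 0 < eps ->
  exists A : {fset I}, forall b, (forall i, 0 <= b i <= a i)%E ->
    (forall i, i \in A -> b i = 0%E) -> (\esum_(i in setT) b i <= eps%:E)%E.
Proof.
move=> a0 afin e0.
have sfin : \esum_(i in setT) a i \is a fin_num.
  by rewrite ge0_fin_numE//; exact: esum_ge0.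
have [_ [F [finF _] <-] hF] := ub_ereal_sup_adherent e0 sfin.
exists (fset_set F) => b ba bA.
rewrite -/(\esum_(i in setT) a i) in hF.
have aE : (\esum_(i in setT) a i = \sum_(i \in F) a i + \esum_(i in ~` F) a
  i)%E.
  by rewrite (esumID F)// setTI setTI esum_fset.
have Ffin : (\sum_(i \in F) a i)%E \is a fin_num.
  move: sfin; rewrite aE fin_numD => /andP[]//.
have bF : (\esum_(i in setT) b i <= \esum_(i in ~` F) a i)%E.
  rewrite [leRHS]esum_mkcond; apply: le_esum => i _.
  case: ifPn => [_|]; first by case/andP: (ba i).
  rewrite notin_setE => /contrapT Fi; rewrite bA//.
  by rewrite in_fset_set// inE.
apply: le_trans bF _; move: hF; rewrite aE => hF.
have : (\sum_(i \in F) a i + \esum_(i in ~` F) a i - eps%:E < \sum_(i \in F) a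
  i)%E by [].
rewrite lteBlDr// => h; apply: ltW; move: h.
by rewrite lteD2lE.
Qed.

Lemma esumZl (c : R) a : 0 < c -> (forall i, 0 <= a i)%E ->
  (\esum_(i in setT) (c%:E * a i) = c%:E * \esum_(i in setT) a i)%E.
Proof.
have le (k : R) b : 0 < k -> (forall i, 0 <= b i)%E ->
    (\esum_(i in setT) (k%:E * b i) <= k%:E * \esum_(i in setT) b i)%E.
  move=> k0 b0; apply: ge_ereal_sup => _ [F FT <-].
  rewrite -ge0_mule_fsumr// lee_pmul2l//.
  by apply: ereal_sup_ubound; exists F.
move=> c0 a0; apply/eqP; rewrite eq_le le//=.
have ca0 i : (0 <= c%:E * a i)%E by rewrite mule_ge0// lee_fin ltW.
have := le c^-1 (fun i => c%:E * a i)%E _ ca0.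
rewrite invr_gt0 => /(_ c0); rewrite lee_pdivlMl//.
by under eq_esum do rewrite muleA -EFinM mulVf ?gt_eqF// mul1e.
Qed.

End EsumTail.

Section Coefficients.
Context {R : realType} {d : measure_display} {T : measurableType d}.
Context {P : probability T R} {p q : nat -> R} {X : nat -> {RV P >-> R}}.
Hypothesis H : rademacher p q X.

Local Notation L2 := (Lfun P 2%:E).
Local Notation Y := (normalised p q X).
Local Notation L2S := (L2_sigma P Y).
Local Notation walsh := (walsh p q X).

Definition wcoef (u : T -> R) (S : {fset nat}) : R := dot P u (walsh S).

Lemma wcoefD u v S : u \in L2 -> v \in L2 -> wcoef (u \+ v) S =
    wcoef u S + wcoef v S.
Proof. by move=> uL vL; rewrite /wcoef dotDl//; exact: walsh_L2 H S. Qed.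

Lemma wcoefB u v S : u \in L2 -> v \in L2 -> wcoef (u \- v) S =
    wcoef u S - wcoef v S.
Proof. by move=> uL vL; rewrite /wcoef dotBl//; exact: walsh_L2 H S. Qed.

Lemma wcoefZ c u S : u \in L2 -> wcoef (fun w => c * u w) S = c * wcoef u S.
Proof. by move=> uL; rewrite /wcoef dotZl//; exact: walsh_L2 H S. Qed.

Lemma wcoef_sum (I : Type) (r : seq I) (Q : pred I) (F : I -> T -> R) S :
  (forall i, Q i -> F i \in L2) ->
  wcoef (fun w => \sum_(i <- r | Q i) F i w) S =
    \sum_(i <- r | Q i) wcoef (F i) S.
Proof. by move=> FL; rewrite /wcoef dot_suml//; exact: walsh_L2 H S. Qed.

Lemma wcoef_walsh S S' : wcoef (walsh S) S' = (S == S')%:R.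
Proof. by rewrite /wcoef (dot_walsh H). Qed.

Definition walsh_sum (A : {fset {fset nat}}) (a : {fset nat} -> R) (w : T) :
    R :=
  \sum_(S <- A) a S * walsh S w.

Lemma L2S_walsh_sum A a : L2S (walsh_sum A a).
Proof. by apply: L2S_sum => S _; apply: L2SZ; exact: L2S_walsh H S. Qed.

Lemma walsh_sum_L2 A a : walsh_sum A a \in L2.
Proof. exact: L2S_L2 (L2S_walsh_sum A a). Qed.

Lemma wcoef_walsh_sum A a S : wcoef (walsh_sum A a) S =
    if S \in A then a S else 0.
Proof.
rewrite wcoef_sum; last by move=> S' _; apply: L2Z; exact: walsh_L2 H S'.
rewrite (eq_bigr (fun S' => a S' * (S' == S)%:R)) => [|S' _]; last first.
  by rewrite wcoefZ ?wcoef_walsh//; exact: walsh_L2 H S'.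
case: ifPn => SA; last first.
  rewrite big_seq big1// => S' S'A; case: eqVneq => [e|_];
    last by rewrite mulr0.
  by rewrite -e S'A in SA.
rewrite (big_fsetD1 S)//= eqxx mulr1 big_seq big1 ?addr0// => S'.
by rewrite !inE => /andP[/negbTE -> _]; rewrite mulr0.
Qed.

Lemma dot_walsh_sum A a u : u \in L2 ->
  dot P (walsh_sum A a) u = \sum_(S <- A) a S * wcoef u S.
Proof.
move=> uL; rewrite dot_suml//; last by move=> S _; apply: L2Z;
  exact: walsh_L2 H S.
apply: eq_bigr => S _; rewrite dotZl//; last exact: walsh_L2 H S.
by rewrite dotC.
Qed.

Lemma dot_walsh_sum_self A a :
  dot P (walsh_sum A a) (walsh_sum A a) = \sum_(S <- A) a S ^+ 2.
Proof.
rewrite dot_walsh_sum; last exact: walsh_sum_L2.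
by rewrite !big_seq; apply: eq_bigr => S SA; rewrite wcoef_walsh_sum SA expr2.
Qed.

Lemma wcoef_ae u v : L2S u -> L2S v -> (forall S, wcoef u S = wcoef v S) ->
  {ae P, forall w, u w = v w}.
Proof.
move=> uS vS uv.
have h : {ae P, forall w, (u \- v) w = 0}.
  apply: (walsh_complete H); first exact: L2SB.
  move=> S; have := wcoefB S (L2S_L2 uS) (L2S_L2 vS).
  by rewrite /wcoef => ->; rewrite -/(wcoef u S) uv subrr.
by apply: filterS h => w /= /eqP; rewrite subr_eq0 => /eqP.
Qed.

(** Expand the squared norm of u minus its orthogonal projection on the span of
    the W_S for S in A. *)
Lemma bessel u (A : {fset {fset nat}}) : u \in L2 ->
  \sum_(S <- A) wcoef u S ^+ 2 <= dot P u u.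
Proof.
move=> uL; have := dot_ge0 P (u \- walsh_sum A (wcoef u)).
have sL := walsh_sum_L2 A (wcoef u).
rewrite dotBl//; last exact: L2B.
rewrite !dotBr// dot_walsh_sum_self dotC dot_walsh_sum//.
under [X in _ - X - _]eq_bigr do rewrite -expr2.
lra.
Qed.

(** Choosing increasing finite sets B n outside which the squares sum to at
    most 4^(-n), the partial sums converge at a geometric rate. These partial
    sums are part of the conclusion because they approximate G by finite Walsh
    sums. *)
Lemma riesz_fischer (a : {fset nat} -> R) :
  (\esum_(S in setT) (a S ^+ 2)%:E < +oo)%E ->
  exists G, exists B : nat -> {fset {fset nat}},
    [/\ L2S G, forall S, wcoef G S = a S,
    ((dot P G G)%:E = \esum_(S in setT) (a S ^+ 2)%:E)%E &
    dot P (walsh_sum (B n) a \- G) (walsh_sum (B n) a \- G) @[n --> \oo] --> 0].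
Proof.
move=> afin; have a0 S : (0 <= (a S ^+ 2)%:E)%E by rewrite lee_fin sqr_ge0.
have /choice[A hA] : forall n, exists A : {fset {fset nat}},
  forall b : {fset nat} -> \bar R,
    (forall S, 0 <= b S <= (a S ^+ 2)%:E)%E ->
    (forall S, S \in A -> b S = 0%E) ->
    (\esum_(S in setT) b S <= (2^-1 ^+ n ^+ 2)%:E)%E.
  by move=> n; apply: esum_tail => //; rewrite !exprn_gt0.
(* Unions make the index sets increase with n. *)
pose B n := (\bigcup_(m <- iota 0 n.+1) A m)%fset.
have AB n : (A n `<=` B n)%fset.
  by apply: bigfcup_sup => //; rewrite mem_iota add0n leq0n ltnSn.
have BB n m : (n <= m)%N -> (B n `<=` B m)%fset.
  move=> nm; apply/bigfcupsP => i; rewrite mem_iota => /andP[_ ni] _.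
  apply: bigfcup_sup => //; rewrite mem_iota /=.
  by apply: leq_trans ni _; rewrite !add0n ltnS.
pose rest n S := if S \in B n then 0 else a S.
have tail n : (\esum_(S in setT) (rest n S ^+ 2)%:E <= (2^-1 ^+ n ^+ 2)%:E)%E.
  apply: hA => S; rewrite /rest.
    by case: ifP => _; rewrite ?expr0n/= ?lexx ?a0.
  by move=> /(fsubsetP (AB n)) ->; rewrite expr0n.
have fast n m : (n <= m)%N ->
    dot P (walsh_sum (B m) a \- walsh_sum (B n) a)
      (walsh_sum (B m) a \- walsh_sum (B n) a) <= 2^-1 ^+ n ^+ 2.
  move=> nm; have -> : walsh_sum (B m) a \- walsh_sum (B n) a =
    walsh_sum (B m) (rest n).
    apply/funext => w /=; rewrite /walsh_sum.
    have -> : \sum_(S <- B n) a S * walsh S w =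
        \sum_(S <- B m) (if S \in B n then a S else 0) * walsh S w.
      rewrite -(big_fset_incl _ (BB _ _ nm)) => [|S _ /negbTE ->];
        last by rewrite mul0r.
      by apply: eq_big_seq => S ->.
    rewrite -sumrB; apply: eq_bigr => S _; rewrite /rest.
    by case: ifP => _; rewrite ?mul0r ?subrr ?subr0.
  rewrite dot_walsh_sum_self -lee_fin -sumEFin; apply: le_trans (tail n).
  by apply: fsum_le_esum => S; rewrite lee_fin sqr_ge0.
have [|||G [mG GL hG]] := @fast_cauchy_lim _ _ _ P (cylinders Y)
  (cylinders_measurable (X := X)) (fun n => walsh_sum (B n) a).
- by move=> n; case: (L2S_walsh_sum (B n) a).
- by move=> n; exact: walsh_sum_L2.
- exact: fast.
have GS : L2S G by split.
have half0 : (2^-1 : R) ^+ n ^+ 2 @[n --> \oo] --> 0.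
  have h : (2^-1 : R) ^+ n @[n --> \oo] --> 0.
    by apply: cvg_expr; rewrite ger0_norm ?invr_ge0// invf_lt1// ltr1n.
  by rewrite -[X in _ --> X](mulr0 0); exact: (cvgM h h).
have Gcvg : dot P (walsh_sum (B n) a \- G) (walsh_sum (B n) a \- G) @[n -->
  \oo] --> 0.
  apply: (squeeze_cvgr _ (cvg_cst 0) half0).
  by apply: nearW => n; rewrite hG dot_ge0.
exists G, B; split => //.
- move=> S.
  have h1 : wcoef (walsh_sum (B n) a) S @[n --> \oo] --> wcoef G S.
    by apply: dot_cvgl Gcvg => // [n|];
      [exact (walsh_sum_L2 _ _)|exact (walsh_L2 H S)].
  have h2 : wcoef (walsh_sum (B n) a) S @[n --> \oo] --> a S.
    have -> : (fun n => wcoef (walsh_sum (B n) a) S) =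
      (fun n => a S - rest n S).
      apply/funext => n; rewrite wcoef_walsh_sum /rest.
      by case: ifP; rewrite ?subr0 ?subrr.
    rewrite -[X in _ --> X]subr0; apply: cvgB; first exact: cvg_cst.
    have h : Num.sqrt (rest n S ^+ 2) @[n --> \oo] --> (0 : R).
      rewrite -(@sqrtr0 R); apply: continuous_cvg; first exact: sqrt_continuous.
      apply: (squeeze_cvgr _ (cvg_cst 0) half0); apply: nearW => n.
      rewrite sqr_ge0/= -lee_fin; apply: le_trans (tail n).
      have := @fsum_le_esum R _ [fset S]%fset (fun S => (rest n S ^+ 2)%:E).
      by rewrite big_seq_fset1; apply => S'; rewrite lee_fin sqr_ge0.
    by apply/norm_cvg0P; under eq_fun do rewrite -sqrtr_sqr.
  exact (cvg_unique (@Rhausdorff R) h1 h2).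
- have dE n : (\esum_(S in setT) (a S ^+ 2)%:E =
  (dot P (walsh_sum (B n) a) (walsh_sum (B n) a))%:E
      + \esum_(S in setT) (rest n S ^+ 2)%:E)%E.
    rewrite dot_walsh_sum_self -sumEFin.
    rewrite (esumID [set` B n])// setTI setTI; congr (_ + _)%E.
      by rewrite esum_fset// fsbig_finite//= set_fsetK.
    rewrite esum_mkcond; apply: eq_esum => S _; rewrite /rest.
    rewrite in_setC; have -> : (S \in [set` B n]) = (S \in B n)
      by apply/idP/idP; rewrite inE.
    by case: (S \in B n); rewrite /= ?expr0n.
  have sfin : (\esum_(S in setT) (a S ^+ 2)%:E \is a fin_num)%E.
    by rewrite ge0_fin_numE//; exact: esum_ge0.
  set E := (\esum_(S in setT) _)%E in dE sfin *.
  have rfin n : (\esum_(S in setT) (rest n S ^+ 2)%:E \is a fin_num)%E.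
    by move: sfin; rewrite (dE n) fin_numD => /andP[].
  rewrite -(fineK sfin); congr EFin.
  have h1 : dot P (walsh_sum (B n) a) (walsh_sum (B n) a) @[n --> \oo] -->
    dot P G G.
    by apply: dot_cvg_self Gcvg => // n; exact (walsh_sum_L2 _ _).
  have h2 : dot P (walsh_sum (B n) a) (walsh_sum (B n) a) @[n --> \oo] -->
    fine E.
    apply: (squeeze_cvgr (f := fun n => fine E - 2^-1 ^+ n ^+ 2)
      (h := cst (fine E))).
    - apply: nearW => n; rewrite (dE n) fineD// /= lerBlDr lerD2l lerDl
      fine_ge0 ?andbT; last first.
        by apply: esum_ge0 => S _; rewrite lee_fin sqr_ge0.
      by rewrite -lee_fin fineK.
    - rewrite -[X in _ --> X]subr0; apply: cvgB => //; exact: cvg_cst.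
    - exact: cvg_cst.
  exact (cvg_unique (@Rhausdorff R) h1 h2).
Qed.

(** Bessel's inequality makes the coefficients square-summable; the function
    that Riesz-Fischer builds from them has the same coefficients as G, hence
    equals G almost surely. *)
Lemma parseval G : L2S G -> ((dot P G G)%:E =
    \esum_(S in setT) (wcoef G S ^+ 2)%:E)%E.
Proof.
move=> GS; have fin : (\esum_(S in setT) (wcoef G S ^+ 2)%:E < +oo)%E.
  apply: le_lt_trans (ltry (dot P G G));
    apply: ge_ereal_sup => _ [F [finF _] <-].
  rewrite fsbig_finite//= sumEFin lee_fin; exact: bessel (L2S_L2 GS).
have [G' [B [G'S G'c G'd _]]] := riesz_fischer fin.
have [GL G'L] := (L2S_L2 GS, L2S_L2 G'S).
rewrite -G'd; congr EFin; apply: (dot_ae GL GL G'L G'L).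
have GG' S : wcoef G S = wcoef G' S by rewrite G'c.
by apply: filterS (wcoef_ae GS G'S GG') => w ->.
Qed.

End Coefficients.

(** * Multiple integrals *)

Section Tuples.
Implicit Types (n : nat) (S : {fset nat}).

Definition set_of_tuple n (i : n.-tuple nat) : {fset nat} :=
    [fset x in tval i]%fset.

Lemma mem_set_of_tuple n (i : n.-tuple nat) x : (x \in set_of_tuple i) =
    (x \in tval i).
Proof. by rewrite /set_of_tuple !inE. Qed.

Lemma perm_set_of_tuple n (i : n.-tuple nat) : uniq i ->
    perm_eq (set_of_tuple i) i.
Proof.
move=> ui; apply: uniq_perm => //.
by move=> x; rewrite -mem_set_of_tuple.
Qed.

(** The n-tuples of distinct entries with set of entries S; this list is empty
    when S does not have n elements. *)
Definition orderings n S : seq (n.-tuple nat) :=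
    pmap insub (permutations (enum_fset S)).

Lemma mem_orderings n S (i : n.-tuple nat) :
  (i \in orderings n S) = uniq i && (set_of_tuple i == S).
Proof.
rewrite /orderings mem_pmap_sub mem_permutations.
apply/idP/idP => [h|/andP[ui /eqP <-]];
  last by rewrite perm_sym perm_set_of_tuple.
have ui : uniq i by rewrite (perm_uniq h) fset_uniq.
rewrite ui /=; apply/eqP/fsetP => x.
by rewrite mem_set_of_tuple (perm_mem h).
Qed.

Lemma uniq_orderings n S : uniq (orderings n S).
Proof. by apply: pmap_sub_uniq; exact: permutations_uniq. Qed.

Lemma card_set_of_tuple n (i : n.-tuple nat) : uniq i -> #|` set_of_tuple i| =
    n.
Proof.
by move=> ui; rewrite (perm_size (perm_set_of_tuple ui)) size_tuple.
Qed.

Lemma orderings_nil n S : #|` S| != n -> orderings n S = [::].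
Proof.
move=> Sn; case E : (orderings n S) => [//|i r]; case/eqP: Sn.
have : i \in orderings n S by rewrite E mem_head.
by rewrite mem_orderings => /andP[ui /eqP <-]; exact: card_set_of_tuple.
Qed.

Lemma size_orderings n S : #|` S| = n -> size (orderings n S) = n`!.
Proof.
move=> Sn; rewrite /orderings size_pmap_sub -Sn.
rewrite -[RHS](size_permutations (fset_uniq S)); apply/eqP; rewrite -all_count.
by apply/allP => s; rewrite mem_permutations => /perm_size/eqP.
Qed.

End Tuples.

Section Delta.
Context {R : realType}.

(** A crude constant is enough: it serves only to pass summability from a
    kernel to the coefficients of its multiple integral. *)
Lemma sum_sqr_le (I : Type) (r : seq I) (Q : pred I) (f : I -> R) :
  (\sum_(i <- r | Q i) f i) ^+ 2 <= 2 ^+ size r * \sum_(i <- r | Q i) f i ^+ 2.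
Proof.
elim: r => [|i r IH]; first by rewrite !big_nil expr0n mulr0.
rewrite !big_cons /= [2 ^+ _.+1]exprS; case: ifP => _; last first.
  apply: le_trans IH _; rewrite -mulrA ler_peMl ?ler1n//.
  by rewrite mulr_ge0 ?exprn_ge0 ?sumr_ge0// => j _; rewrite sqr_ge0.
set s := \sum_(_ <- _ | _) f _ in IH *;
  set t := \sum_(_ <- _ | _) _ ^+ 2 in IH *.
have h : (f i + s) ^+ 2 <= 2 * (f i ^+ 2 + s ^+ 2).
  by have := sqr_ge0 (f i - s); lra.
apply: le_trans h _; rewrite -mulrA ler_pM2l// mulrDr lerD//.
by rewrite ler_peMl ?sqr_ge0// exprn_ege1// ler1n.
Qed.

(** The tuples off the diagonals are partitioned by their set of entries. *)
Lemma esum_Delta n (g : n.-tuple nat -> \bar R) : (forall i, 0 <= g i)%E ->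
  (\esum_(S in [set: {fset nat}]) \sum_(i <- orderings n S) g i =
   \esum_(i in Delta (n:=n)) g i)%E.
Proof.
move=> g0.
transitivity (\esum_(S in [set: {fset nat}]) \esum_(i in [set` orderings n S])
  g i)%E.
  apply: eq_esum => S _; rewrite esum_fset//; last exact: finite_seq.
  by rewrite fsbig_seq// uniq_orderings.
rewrite esum_esum//.
rewrite (reindex_esum (Delta (n:=n)) _ (fun i => (set_of_tuple i, i)))//; split.
- by move=> i ui /=; split => //; rewrite mem_orderings eqxx andbT.
- by move=> i j _ _ [].
- move=> [S i] [_ /=]; rewrite mem_orderings => /andP[ui /eqP iS].
  by exists i => //; rewrite iS.
Qed.

End Delta.

#[local] Existing Instance totally_filter.

Section MultipleIntegrals.
Context {R : realType} {d : measure_display} {T : measurableType d}.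
Context {P : probability T R} {p q : nat -> R} {X : nat -> {RV P >-> R}}.
Hypothesis H : rademacher p q X.

Local Notation L2 := (Lfun P 2%:E).
Local Notation Y := (normalised p q X).
Local Notation L2S := (L2_sigma P Y).
Local Notation walsh := (walsh p q X).
Local Notation wcoef := (@wcoef R d T P p q X).

(** The limit defining a multiple integral or a derivative is identified
    through its coefficients, which are eventually constant along the
    approximations. *)
Lemma wcoef_L2_lim (I : Type) (Phi : set_system I) {FF : ProperFilter Phi}
    (u : I -> T -> R) (G : T -> R) (c : {fset nat} -> R) :
  (forall i, L2S (u i)) -> is_L2_lim P Y Phi u G ->
  (forall S, \forall i \near Phi, wcoef (u i) S = c S) ->
  forall S, wcoef G S = c S.
Proof.
move=> uS [GS uG] uc S.
have uL i : u i \in L2 := L2S_L2 (uS i).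
have GL := L2S_L2 GS.
have ug : dot P (u i \- G) (u i \- G) @[i --> Phi] --> (0 : R).
  by apply/Lnorm_cvg0 => // i; exact: L2B.
have h1 : wcoef (u i) S @[i --> Phi] --> wcoef G S.
  by apply: dot_cvgl ug => //; exact (walsh_L2 H S).
have h2 : wcoef (u i) S @[i --> Phi] --> c S.
  apply: cvg_near_cst; exact: uc.
exact (cvg_unique (@Rhausdorff R) h1 h2).
Qed.

(** By Parseval, convergence in L2 is convergence of the coefficients in l2. *)
Lemma L2_lim_of_wcoef (I : Type) (Phi : set_system I) {FF : Filter Phi}
    (u : I -> T -> R) (G : T -> R) :
  (forall i, L2S (u i)) -> L2S G ->
  (forall eps : R, 0 < eps -> \forall i \near Phi,
    (\esum_(S in setT) ((wcoef (u i) S - wcoef G S) ^+ 2)%:E <= eps%:E)%E) ->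
  is_L2_lim P Y Phi u G.
Proof.
move=> uS GS uc; split=> //; apply/Lnorm_cvg0.
  by move=> i; exact: L2B (L2S_L2 (uS i)) (L2S_L2 GS).
apply/cvgrPdist_le => e e0; apply: filterS (uc e e0) => i.
rewrite sub0r normrN ger0_norm ?dot_ge0// -lee_fin.
rewrite (parseval H (L2SB (uS i) GS)).
move=> h; apply: le_trans h; apply: le_esum => S _.
by rewrite (wcoefB H S (L2S_L2 (uS i)) (L2S_L2 GS)).
Qed.

(** The coefficient at S of the multiple integral of f. *)
Definition kernel_sum n (f : n.-tuple nat -> R) (S : {fset nat}) : R :=
  \sum_(i <- orderings n S) f i.

Lemma kernel_sum_neq n (f : n.-tuple nat -> R) S : #|` S| != n ->
    kernel_sum f S = 0.
Proof. by move=> Sn; rewrite /kernel_sum orderings_nil// big_nil. Qed.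

Lemma kernel_sum_sqr_le n (f : n.-tuple nat -> R) (Q : pred (n.-tuple nat)) S :
  (\sum_(i <- orderings n S | Q i) f i) ^+ 2 <=
  2 ^+ n`! * \sum_(i <- orderings n S | Q i) f i ^+ 2.
Proof.
have [Sn|Sn] := eqVneq #|` S| n;
  last by rewrite orderings_nil// !big_nil expr0n mulr0.
apply: le_trans (sum_sqr_le _ _ _) _; rewrite ler_wpM2r//.
  by apply: sumr_ge0 => i _; rewrite sqr_ge0.
by rewrite size_orderings.
Qed.

(** The partial sums whose limit along finite sets A is J_n(f). *)
Definition multiple_sum n (f : n.-tuple nat -> R) (A : {fset n.-tuple nat})
    (w : T) : R :=
  \sum_(i <- A | i \in Delta (n:=n)) f i * \prod_(j < n) Y (tnth i j) w.

Lemma prod_tuple n (i : n.-tuple nat) w : uniq i ->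
  \prod_(j < n) Y (tnth i j) w = walsh (set_of_tuple i) w.
Proof.
by move=> ui; rewrite /walsh (perm_big _ (perm_set_of_tuple ui)) big_tuple.
Qed.

Lemma multiple_sum_walsh n (f : n.-tuple nat -> R) A :
  multiple_sum f A = fun w => \sum_(i <- A | uniq i) f i * walsh
    (set_of_tuple i) w.
Proof.
apply/funext => w; apply: eq_big => i; first by apply/idP/idP; rewrite inE.
by rewrite inE => ui; rewrite prod_tuple.
Qed.

Lemma L2S_multiple_sum n (f : n.-tuple nat -> R) A : L2S (multiple_sum f A).
Proof.
rewrite multiple_sum_walsh.
apply: (@L2S_sum _ _ _ P p q X _ A (fun i => uniq i)
  (fun i w => f i * walsh (set_of_tuple i) w)) => i _.
by apply: L2SZ; exact (L2S_walsh H _).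
Qed.

Lemma wcoef_multiple_sum n (f : n.-tuple nat -> R) A S :
  wcoef (multiple_sum f A) S = \sum_(i <- orderings n S | i \in A) f i.
Proof.
rewrite multiple_sum_walsh.
rewrite (@wcoef_sum _ _ _ P p q X H _ A (fun i => uniq i)
  (fun i w => f i * walsh (set_of_tuple i) w)); last by move=> i _; apply: L2Z;
    exact (walsh_L2 H _).
transitivity (\sum_(i <- A | i \in orderings n S) f i).
  rewrite big_mkcond [RHS]big_mkcond; apply: eq_bigr => i _.
  rewrite mem_orderings (wcoefZ H); last exact (walsh_L2 H _).
  by rewrite (wcoef_walsh H); case: (uniq i); case: eqP; rewrite ?mulr1 ?mulr0.
rewrite -big_filter -[RHS]big_filter; apply: perm_big; apply: uniq_perm.
- by rewrite filter_uniq// fset_uniq.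
- by rewrite filter_uniq// uniq_orderings.
by move=> i; rewrite !mem_filter andbC.
Qed.

Lemma esum_kernel_sum_le n (f : n.-tuple nat -> R) (Q : pred (n.-tuple nat)) :
  (\esum_(S in [set: {fset nat}])
     ((\sum_(i <- orderings n S | Q i) f i) ^+ 2)%:E <=
   \esum_(i in [set: n.-tuple nat])
     (if Q i then (2 ^+ n`! * f i ^+ 2)%:E else 0))%E.
Proof.
pose g i := (if Q i then (2 ^+ n`! * f i ^+ 2)%:E else 0%E).
have g0 i : (0 <= g i)%E.
  by rewrite /g; case: ifP => // _;
    rewrite lee_fin mulr_ge0 ?sqr_ge0 ?exprn_ge0.
apply: (@le_trans _ _ (\esum_(i in Delta (n:=n)) g i)%E); last first.
  rewrite esum_mkcond; apply: le_esum => i _.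
  by case: ifP => // _; exact: g0.
rewrite -(esum_Delta g0); apply: le_esum => S _.
rewrite /g -big_mkcond/= sumEFin lee_fin -mulr_sumr; exact: kernel_sum_sqr_le.
Qed.

(** The coefficients of the candidate limit are square-summable, since there
    are n! orderings of each S, and the partial sums converge to it by the tail
    estimate. This shows that the limit defining J exists. *)
Lemma J_wcoef n (f : n.-tuple nat -> R) : (sqnorm f < +oo)%E ->
  L2S (J P Y f) /\ forall S, wcoef (J P Y f) S = kernel_sum f S.
Proof.
move=> ffin; pose c : R := 2 ^+ n`!.
have cfin : (\esum_(i in [set: n.-tuple nat]) (c * f i ^+ 2)%:E < +oo)%E.
  rewrite (eq_esum (b := fun i => (c%:E * (f i ^+ 2)%:E)%E))//.
  rewrite esumZl ?exprn_gt0//; last by move=> i; rewrite lee_fin sqr_ge0.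
  by rewrite lte_mul_pinfty// lee_fin exprn_ge0.
have kfin : (\esum_(S in [set: {fset nat}]) (kernel_sum f S ^+ 2)%:E < +oo)%E.
  by apply: le_lt_trans cfin; exact: (esum_kernel_sum_le f predT).
have [G [_ [GS Gc _ _]]] := riesz_fischer H kfin.
have lim : is_L2_lim P Y totally (multiple_sum f) G.
  apply: L2_lim_of_wcoef => //; first by move=> A; exact (L2S_multiple_sum f A).
  move=> e e0.
  have [||A hA] := @esum_tail R _ (fun i : n.-tuple nat => (c * f i ^+ 2)%:E) e
    _ _ e0.
  - by move=> i; rewrite lee_fin mulr_ge0 ?sqr_ge0 ?exprn_ge0.
  - exact: cfin.
  exists A => // B /= AB.
  have -> : (\esum_(S in [set: {fset nat}])
    ((wcoef (multiple_sum f B) S - wcoef G S) ^+ 2)%:E =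
     \esum_(S in [set: {fset nat}])
       ((\sum_(i <- orderings n S | i \notin B) f i) ^+ 2)%:E)%E.
    apply: eq_esum => S _; congr EFin.
    rewrite Gc wcoef_multiple_sum /kernel_sum [X in _ - X](bigID (mem B))/=.
    by rewrite opprD addNKr sqrrN.
  apply: le_trans (esum_kernel_sum_le f (fun i => i \notin B)) _;
    apply: hA => i.
    case: ifP => _; first by rewrite lexx andbT lee_fin mulr_ge0 ?sqr_ge0
      ?exprn_ge0.
    by rewrite lexx lee_fin mulr_ge0 ?sqr_ge0 ?exprn_ge0.
  by move=> iA; rewrite (fsubsetP AB _ iA).
have lim' : is_L2_lim P Y totally (multiple_sum f) (J P Y f).
  by rewrite /J; apply: (@xgetPex _ (cst 0)
    [set G | is_L2_lim P Y totally (multiple_sum f) G]); exists G.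
split; first exact: lim'.1.
apply: (wcoef_L2_lim _ lim'); first by move=> A; exact (L2S_multiple_sum f A).
move=> S; exists [fset i in orderings n S]%fset => // A /= SA.
rewrite wcoef_multiple_sum /kernel_sum big_seq_cond [RHS]big_seq;
  apply: eq_bigl => i.
case: (boolP (i \in orderings n S)) => //= iS.
by apply: (fsubsetP SA); rewrite !inE.
Qed.

End MultipleIntegrals.

(** * Chaos decompositions and the derivative *)

Section EsumExchange.
Context {R : realType} {I K : choiceType}.

Lemma esum_exchange (a : I -> K -> \bar R) : (forall i j, 0 <= a i j)%E ->
  (\esum_(i in setT) \esum_(j in setT) a i j =
   \esum_(j in setT) \esum_(i in setT) a i j)%E.
Proof.
move=> a0; rewrite esum_esum// [RHS]esum_esum//.
rewrite (reindex_esum (setT `*`` (fun=> setT)) _ (fun x : K * I =>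
  (x.2, x.1)))//; split => //=.
- by move=> [x1 x2] [y1 y2] _ _ [-> ->].
- by move=> [x1 x2] _; exists (x2, x1).
Qed.

Lemma esum_single (a : I -> \bar R) (i0 : I) : (forall i, 0 <= a i)%E ->
  (forall i, i != i0 -> a i = 0)%E -> (\esum_(i in setT) a i = a i0)%E.
Proof.
move=> a0 az; rewrite (esumID [set i0])// setTI setTI esum_set1// esum1
  ?adde0//.
by move=> i /eqP; exact: az.
Qed.

End EsumExchange.

(** Adding k is a bijection from the sets without k onto the sets with k. *)
Lemma esum_add_point {R : realType} (k : nat) (g : {fset nat} -> \bar R) :
  (\esum_(S in [set: {fset nat}]) (if k \in S then 0 else g (k |` S)%fset) =
   \esum_(S in [set: {fset nat}]) (if k \in S then g S else 0))%E.
Proof.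
transitivity (\esum_(S in [set S : {fset nat} | k \notin S]) g (k |` S)%fset)%E.
  rewrite [RHS]esum_mkcond; apply: eq_esum => S _.
  have [kS|kS] := boolP (k \in S); last by rewrite mem_set.
  by rewrite memNset//= kS.
transitivity (\esum_(S in [set S : {fset nat} | k \in S]) g S)%E; last first.
  rewrite [LHS]esum_mkcond; apply: eq_esum => S _.
  have [kS|kS] := boolP (k \in S); first by rewrite mem_set.
  by rewrite memNset//=; exact/negP.
apply/esym/reindex_esum; split.
- by move=> S _ /=; rewrite !inE eqxx.
- move=> S S'; rewrite !inE /= => kS kS' e.
  by rewrite -(fsetU1K kS) e fsetU1K.
- move=> S /= kS; exists (S `\ k)%fset => /=; last by rewrite fsetD1K.
  by rewrite !inE eqxx.
Qed.

Section Kernels.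
Context {R : realType}.

Lemma sum_const_seq (I : eqType) (r : seq I) (f : I -> R) c :
  (forall i, i \in r -> f i = c) -> \sum_(i <- r) f i = (size r)%:R * c.
Proof.
move=> fc; rewrite (eq_big_seq (fun=> c))//.
by rewrite big_const_seq count_predT iter_addr addr0 mulr_natl.
Qed.

(** The algebraic part of membership in the space of symmetric kernels
    vanishing on the diagonals, without square-summability. *)
Definition sym_offdiag n (f : n.-tuple nat -> R) : Prop :=
  (forall (s : 'S_n) (i : n.-tuple nat), f [tuple tnth i (s j) | j < n] = f i) /\
  (forall i, ~ Delta i -> f i = 0).

Lemma H0symP n (f : n.-tuple nat -> R) :
  H0sym f <-> (sqnorm f < +oo)%E /\ sym_offdiag f.
Proof. by split => [[? ? ?]|[? [? ?]]]. Qed.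

(** Two orderings of the same set differ by a permutation. *)
Lemma sym_orderings n (f : n.-tuple nat -> R) S i j : sym_offdiag f ->
  i \in orderings n S -> j \in orderings n S -> f i = f j.
Proof.
move=> [fs _]; rewrite !mem_orderings => /andP[ui /eqP iS] /andP[uj /eqP jS].
have : perm_eq i j.
  by apply: uniq_perm => // x; rewrite -!mem_set_of_tuple iS jS.
move=> /tuple_permP[s ij].
by rewrite -(fs s j); congr f; exact: val_inj.
Qed.

Lemma kernel_sum_sym n (f : n.-tuple nat -> R) S i : sym_offdiag f ->
  i \in orderings n S -> kernel_sum f S = n`!%:R * f i.
Proof.
move=> fs iS; rewrite /kernel_sum (sum_const_seq (c := f i)); last first.
  by move=> j jS; exact: sym_orderings jS iS.
congr (_%:R * _); apply: size_orderings.
by move: iS; rewrite mem_orderings => /andP[ui /eqP <-];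
  exact: card_set_of_tuple.
Qed.

(** The isometry n! ||f||^2 = ||J_n(f)||^2: a symmetric kernel is constant on
    the n! orderings of S. *)
Lemma sqnorm_kernel_sum n (f : n.-tuple nat -> R) : sym_offdiag f ->
  (n`!%:R%:E * sqnorm f = \esum_(S in [set: {fset nat}])
    (kernel_sum f S ^+ 2)%:E)%E.
Proof.
move=> fs; have f0 i : (0 <= (f i ^+ 2)%:E)%E by rewrite lee_fin sqr_ge0.
have -> : sqnorm f = (\esum_(i in Delta (n:=n)) (f i ^+ 2)%:E)%E.
  rewrite /sqnorm [RHS]esum_mkcond; apply: eq_esum => i _.
  by case: ifPn => //; rewrite notin_setE => /fs.2 ->; rewrite expr0n.
rewrite -esum_Delta// -esumZl ?ltr0n ?fact_gt0//; last first.
  by move=> S; rewrite sume_ge0.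
apply: eq_esum => S _; rewrite sumEFin -EFinM; congr EFin.
have [Sn|Sn] := eqVneq #|` S| n; last first.
  by rewrite kernel_sum_neq// orderings_nil// big_nil mulr0 expr0n.
have : (0 < size (orderings n S))%N by rewrite size_orderings// fact_gt0.
case E : (orderings n S) => [//|i r] _; rewrite -E.
have iS : i \in orderings n S by rewrite E mem_head.
rewrite (sum_const_seq (c := f i ^+ 2)); last first.
  by move=> j jS; rewrite (sym_orderings fs jS iS).
by rewrite size_orderings// (kernel_sum_sym fs iS); ring.
Qed.

Lemma sqnorm_last_section n (f : n.+1.-tuple nat -> R) k :
  (sqnorm (last_section f k) <= sqnorm f)%E.
Proof.
rewrite /sqnorm /last_section.
rewrite -(esum_image setT (fun i : n.-tuple nat => [tuple of rcons i k])
  (fun j => (f j ^+ 2)%:E)).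
  rewrite esum_mkcond; apply: le_esum => i _; case: ifP => // _.
  by rewrite lee_fin sqr_ge0.
move=> i j _ _ /(congr1 val) /= /eqP; rewrite eqseq_rcons => /andP[/eqP ij _].
exact: val_inj.
Qed.

(** Appending k to an ordering of S orders S + k, and (m + 1) m! = (m + 1)!; if
    k is in S the tuple obtained lies on a diagonal. *)
Lemma kernel_sum_last_section m (f : m.+1.-tuple nat -> R) k S :
  sym_offdiag f ->
  #|` S| = m ->
  m.+1%:R * kernel_sum (last_section f k) S =
    if k \in S then 0 else kernel_sum f (k |` S)%fset.
Proof.
move=> fs Sm; case: ifPn => kS.
  rewrite /kernel_sum big_seq big1 ?mulr0// => i.
  rewrite mem_orderings => /andP[ui /eqP iS]; apply: fs.2 => /=.
  by rewrite /Delta /= rcons_uniq -mem_set_of_tuple iS kS.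
rewrite /kernel_sum -/(kernel_sum f _).
rewrite (sum_const_seq (c := kernel_sum f (k |` S)%fset / (m.+1)`!%:R));
  last first.
  move=> i; rewrite mem_orderings => /andP[ui /eqP iS].
  rewrite (kernel_sum_sym (i := [tuple of rcons i k]) fs).
    by rewrite /last_section mulrC mulKf// pnatr_eq0 -lt0n fact_gt0.
  rewrite mem_orderings /= rcons_uniq ui -mem_set_of_tuple iS kS /=.
  by apply/eqP/fsetP => x; rewrite mem_set_of_tuple /= mem_rcons !inE -iS
    mem_set_of_tuple.
rewrite size_orderings// factS natrM; field.
by rewrite nat1r !pnatr_eq0 -lt0n fact_gt0.
Qed.

End Kernels.

Section Chaos.
Context {R : realType} {d : measure_display} {T : measurableType d}.
Context {P : probability T R} {p q : nat -> R} {X : nat -> {RV P >-> R}}.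
Hypothesis H : rademacher p q X.

Local Notation L2 := (Lfun P 2%:E).
Local Notation Y := (normalised p q X).
Local Notation L2S := (L2_sigma P Y).
Local Notation walsh := (walsh p q X).
Local Notation wcoef := (@wcoef R d T P p q X).

Lemma walsh0 : walsh fset0 = cst 1.
Proof. by apply/funext => w; rewrite /walsh big_seq_fset0. Qed.

Lemma wcoef_cst c S : wcoef (cst c) S = if S == fset0 then c else 0.
Proof.
have -> : cst c = (fun w => c * walsh fset0 w).
  by apply/funext => w; rewrite walsh0 mulr1.
rewrite (wcoefZ H) ?(wcoef_walsh H); last exact (walsh_L2 H _).
by rewrite eq_sym; case: eqP => _; rewrite ?mulr1 ?mulr0.
Qed.

Lemma wcoef0 F : fine 'E_P[F] = wcoef F fset0.
Proof.
rewrite unlock /wcoef walsh0 /dot /Rintegral; congr fine.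
by apply: eq_integral => w _; rewrite mulr1.
Qed.

Lemma sum_kernel_sum (f : forall n, n.-tuple nat -> R) m N S :
  \sum_(m <= n < N) kernel_sum (f n) S =
  if (m <= #|` S| < N)%N then kernel_sum (f #|` S|) S else 0.
Proof.
case: ifPn => h.
  rewrite (bigD1_seq #|` S|) ?mem_index_iota ?iota_uniq//= big1 ?addr0// =>
    n nS.
  by rewrite kernel_sum_neq// eq_sym.
rewrite big_seq big1// => n; rewrite mem_index_iota => nN.
by apply: kernel_sum_neq; apply: contraNneq h => ->.
Qed.

(** Truncations by the cardinality of S converge: a finite set of indices
    carries all but a small part of the squared coefficients. *)
Lemma L2_lim_of_partial (u : nat -> T -> R) G :
  (forall N, L2S (u N)) -> L2S G ->
  (forall N S, (#|` S| < N)%N -> wcoef (u N) S = wcoef G S) ->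
  (forall N S, wcoef (u N) S = wcoef G S \/ wcoef (u N) S = 0) ->
  is_L2_lim P Y \oo u G.
Proof.
move=> uS GS ueq u0; apply: (L2_lim_of_wcoef H) => // e e0.
have [||A hA] := @esum_tail R _ (fun S => (wcoef G S ^+ 2)%:E) e _ _ e0.
- by move=> S; rewrite lee_fin sqr_ge0.
- by rewrite -(parseval H GS) ltry.
exists (\max_(S <- A) #|` S|).+1 => // N /= AN; apply: hA => S.
  rewrite !lee_fin sqr_ge0; case: (u0 N S) => ->;
    last by rewrite sub0r sqrrN /=.
  by rewrite subrr expr0n sqr_ge0.
move=> SA; rewrite ueq ?subrr ?expr0n//.
by apply: leq_trans AN; rewrite ltnS (big_fsetD1 S)//= leq_maxl.
Qed.

Definition chaos_sum (F : T -> R) (f : forall n, n.-tuple nat -> R) N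
    (w : T) : R :=
  fine 'E_P[F] + \sum_(1 <= n < N) J P Y (f n) w.

Lemma chaos_sum_wcoef F (f : forall n, n.-tuple nat -> R) N :
  (forall n, (0 < n)%N -> H0sym (f n)) ->
  L2S (chaos_sum F f N) /\ forall S, wcoef (chaos_sum F f N) S =
    if S == fset0 then wcoef F fset0
    else if (#|` S| < N)%N then kernel_sum (f #|` S|) S else 0.
Proof.
move=> fH.
have Jn n : (0 < n)%N -> L2S (J P Y (f n)) /\ forall S, wcoef (J P Y (f n)) S =
  kernel_sum (f n) S.
  by move=> n0; apply: (J_wcoef H); case: (fH n n0).
have sumS : L2S (fun w => \sum_(1 <= n < N) J P Y (f n) w).
  under eq_fun do rewrite big_nat_cond.
  by apply: L2S_sum => n /andP[/andP[n0 _] _]; case: (Jn n n0).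
have cS : L2S (cst (fine 'E_P[F])) by exact: L2S_cst.
split; first exact: (L2SD cS sumS).
move=> S; have := wcoefD H S (L2S_L2 cS) (L2S_L2 sumS).
rewrite /chaos_sum => ->; rewrite wcoef_cst -wcoef0.
have -> : wcoef (fun w => \sum_(1 <= n < N) J P Y (f n) w) S =
    \sum_(1 <= n < N) kernel_sum (f n) S.
  have -> : (fun w => \sum_(1 <= n < N) J P Y (f n) w) =
      (fun w => \sum_(1 <= n < N | (1 <= n < N)%N && true) J P Y (f n) w).
    by apply/funext => w; rewrite big_nat_cond.
  rewrite (wcoef_sum H) => [|n /andP[/andP[n0 _] _]];
    last by case: (Jn n n0) => /L2S_L2.
  rewrite [RHS]big_nat_cond; apply: eq_bigr => n /andP[/andP[n0 _] _].
  by case: (Jn n n0).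
rewrite sum_kernel_sum; case: eqVneq => [->|S0]; first by rewrite cardfs0 addr0.
by rewrite add0r lt0n cardfs_eq0 S0.
Qed.

Lemma chaos_decomposition_wcoef F f : chaos_decomposition P Y F f ->
  forall S, S != fset0 -> wcoef F S = kernel_sum (f #|` S|) S.
Proof.
move=> [fH lim] S S0.
rewrite (wcoef_L2_lim H (c := fun S => if S == fset0 then wcoef F fset0 else
  kernel_sum (f #|` S|) S) _ lim).
- by rewrite (negbTE S0).
- by move=> N; case: (chaos_sum_wcoef F N fH).
move=> S'; exists #|` S'|.+1 => // N /= SN.
by case: (chaos_sum_wcoef F N fH) => _ ->; rewrite SN.
Qed.

Lemma wcoef_chaos_decomposition F f : L2S F ->
  (forall n, (0 < n)%N -> H0sym (f n)) ->
  (forall S, S != fset0 -> wcoef F S = kernel_sum (f #|` S|) S) ->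
  chaos_decomposition P Y F f.
Proof.
move=> FS fH Ff; split=> //; apply: L2_lim_of_partial => //.
- by move=> N; case: (chaos_sum_wcoef F N fH).
- move=> N S SN; case: (chaos_sum_wcoef F N fH) => _ ->; rewrite SN.
  by case: eqVneq => [->//|S0]; rewrite -Ff.
- move=> N S; case: (chaos_sum_wcoef F N fH) => _ ->.
  case: eqVneq => [->|S0]; first by left.
  by case: ifP => _; [left; rewrite -Ff|right].
Qed.

(** The kernels of the chaos decomposition of F, recovered from its
    coefficients. *)
Definition kernel_of (F : T -> R) n (i : n.-tuple nat) : R :=
  if uniq i then wcoef F (set_of_tuple i) / n`!%:R else 0.

Lemma kernel_of_sym F n : sym_offdiag (kernel_of F (n:=n)).
Proof.
split=> [s i|i]; last by rewrite /kernel_of /Delta /= => /negP/negbTE ->.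
have pe : perm_eq [tuple tnth i (s j) | j < n] i by apply/tuple_permP; exists s.
rewrite /kernel_of (perm_uniq pe); case: ifP => // _; congr (wcoef F _ / _).
by apply/fsetP => x; rewrite !mem_set_of_tuple (perm_mem pe).
Qed.

Lemma kernel_sum_kernel_of F S : kernel_sum (kernel_of F (n:=#|` S|)) S =
    wcoef F S.
Proof.
rewrite /kernel_sum (sum_const_seq (c := wcoef F S / (#|` S|)`!%:R));
  last first.
  by move=> i; rewrite mem_orderings /kernel_of => /andP[-> /eqP ->].
by rewrite size_orderings// mulrC divfK// pnatr_eq0 -lt0n fact_gt0.
Qed.

Lemma kernel_of_H0sym F n : L2S F -> H0sym (kernel_of F (n:=n)).
Proof.
move=> FS; apply/H0symP; split; last exact: kernel_of_sym.
have h : (n`!%:R%:E * sqnorm (kernel_of F (n:=n)) < +oo)%E.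
  rewrite sqnorm_kernel_sum; last exact: kernel_of_sym.
  apply: le_lt_trans (ltry (dot P F F)); rewrite (parseval H FS).
  apply: le_esum => S _; rewrite lee_fin.
  have [Sn|Sn] := eqVneq #|` S| n;
    last by rewrite kernel_sum_neq// expr0n /= sqr_ge0.
  by subst n; rewrite kernel_sum_kernel_of.
move: h; case: (sqnorm _) => [r _|h|_]; [exact: ltry| |by []].
move: h.
by rewrite gt0_muley ?lte_fin ?ltr0n ?fact_gt0.
Qed.

(** The sum over n of n n! ||f_n||^2, read on the coefficients. *)
Definition energy (F : T -> R) : \bar R :=
  (\esum_(S in [set: {fset nat}]) (#|` S|%:R * wcoef F S ^+ 2)%:E)%E.

(** Exchange the sums over n and S: only n = |S| contributes at S. *)
Lemma energyE F (f : forall n, n.-tuple nat -> R) :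
  (forall n, (0 < n)%N -> sym_offdiag (f n)) ->
  (forall S, S != fset0 -> wcoef F S = kernel_sum (f #|` S|) S) ->
  (\sum_(1 <= n <oo) ((n * n`!)%:R)%:E * sqnorm (f n) = energy F)%E.
Proof.
move=> fs Ff.
pose t n S := (n%:R * kernel_sum (f n) S ^+ 2)%:E.
have t0 n S : (0 <= t n S)%E by rewrite lee_fin mulr_ge0 ?sqr_ge0.
rewrite eseries_cond/=.
have -> : (\sum_(i <oo | (1 <= i)%N) ((i * i`!)%:R)%:E * sqnorm (f i) =
   \sum_(i <oo | (1 <= i)%N) \esum_(S in [set: {fset nat}]) t i S)%E.
  apply: eq_eseriesr => n n0.
  rewrite natrM EFinM -muleA sqnorm_kernel_sum; last exact: fs.
  rewrite -esumZl ?ltr0n//; last by move=> S; rewrite lee_fin sqr_ge0.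
rewrite nneseries_esum; last by move=> n _; apply: esum_ge0.
rewrite esum_mkcond.
have -> : (\esum_(i in [set: nat]) (if i \in [set n | (0 < n)%N] then
     \esum_(S in [set: {fset nat}]) t i S else 0) =
   \esum_(i in [set: nat]) \esum_(S in [set: {fset nat}]) t i S)%E.
  apply: eq_esum => i _; case: ifPn => //; rewrite notin_setE /= => /negP.
  by rewrite -eqn0Ngt => /eqP ->; rewrite esum1// => S _; rewrite /t mul0r.
rewrite esum_exchange//; apply: eq_esum => S _.
rewrite (esum_single (i0 := #|` S|))//; last first.
  by move=> n nS; rewrite /t kernel_sum_neq ?expr0n ?mulr0// eq_sym.
rewrite /t; have [->|S0] := eqVneq S fset0; first by rewrite cardfs0 !mul0r.
by rewrite Ff.
Qed.

(** The coefficients determine symmetric kernels, so the existential over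
    kernels in the definition of the domain disappears. *)
Lemma malliavin_domainP F :
  malliavin_domain P Y F <-> L2S F /\ (energy F < +oo)%E.
Proof.
split=> [[f [fc ffin]]|[FS Ffin]].
  split; first by case: fc => _ [].
  rewrite -(energyE (f := f))//; last exact: chaos_decomposition_wcoef.
  by move=> n n0; case: fc => /(_ n n0)/H0symP[].
exists (fun n => kernel_of F (n:=n)); split.
  apply: wcoef_chaos_decomposition => // [n _|S _];
    first exact: kernel_of_H0sym.
  by rewrite kernel_sum_kernel_of.
rewrite (@energyE F (fun n => kernel_of F (n:=n)))// => [n _|S _].
  exact: kernel_of_sym.
by rewrite kernel_sum_kernel_of.
Qed.

Definition derivative_sum (f : forall n, n.-tuple nat -> R) k N (w : T) : R :=
  \sum_(0 <= m < N) m.+1%:R * J P Y (last_section (f m.+1) k) w.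

Lemma derivative_sum_wcoef F f k N : chaos_decomposition P Y F f ->
  L2S (derivative_sum f k N) /\ forall S, wcoef (derivative_sum f k N) S =
    if (#|` S| < N)%N then (if k \in S then 0 else wcoef F (k |` S)%fset)
    else 0.
Proof.
move=> Ff; have fH n : (0 < n)%N -> H0sym (f n) by case: Ff => h _; exact: h.
have Jn m : L2S (J P Y (last_section (f m.+1) k)) /\
    forall S, wcoef (J P Y (last_section (f m.+1) k)) S =
      kernel_sum (last_section (f m.+1) k) S.
  apply: (J_wcoef H); apply: le_lt_trans (sqnorm_last_section _ _) _.
  by case: (fH m.+1 isT).
split.
  by apply: L2S_sum => m _; apply: L2SZ; case: (Jn m).
move=> S; rewrite /derivative_sum (wcoef_sum H); last first.
  by move=> m _; apply: L2Z; case: (Jn m) => /L2S_L2.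
transitivity (\sum_(0 <= m < N) kernel_sum (fun i =>
  m.+1%:R * last_section (f m.+1) k i) S).
  apply: eq_bigr => m _; rewrite (wcoefZ H); last by case: (Jn m) => /L2S_L2.
  by case: (Jn m) => _ ->; rewrite /kernel_sum mulr_sumr.
rewrite (sum_kernel_sum (fun m i => m.+1%:R * last_section (f m.+1) k i)) leq0n
  /=.
case: ifP => // SN; rewrite /kernel_sum -mulr_sumr -/(kernel_sum _ _)
  kernel_sum_last_section//; last first.
  by case/H0symP: (fH #|` S|.+1 isT).
case: ifPn => // kS; rewrite (chaos_decomposition_wcoef Ff); last first.
  by apply/fset0Pn; exists k; rewrite !inE eqxx.
by rewrite cardfsU1 kS.
Qed.

(** This makes the derivative independent of the choices in its definition: its
    coefficients are those of the series in the definition, which converges by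
    Riesz-Fischer. *)
Lemma D_wcoef F k : malliavin_domain P Y F -> L2S (D P Y k F) /\
  forall S, wcoef (D P Y k F) S = if k \in S then 0 else wcoef F (k |` S)%fset.
Proof.
move=> Fd.
pose Q := [set G | exists f, malliavin_kernels P Y F f /\ is_L2_lim P Y \oo
  (derivative_sum f k) G].
have QD : Q (D P Y k F).
  apply: (@xgetPex _ (cst 0) Q).
  have [f [fc ffin]] := Fd.
  pose c S := if k \in S then 0 else wcoef F (k |` S)%fset.
  have cfin : (\esum_(S in [set: {fset nat}]) (c S ^+ 2)%:E < +oo)%E.
    have -> : (\esum_(S in [set: {fset nat}]) (c S ^+ 2)%:E =
      \esum_(S in [set: {fset nat}])
        (if k \in S then 0 else (wcoef F (k |` S)%fset ^+ 2)%:E))%E.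
      by apply: eq_esum => S _; rewrite /c; case: ifP; rewrite ?expr0n.
    rewrite (esum_add_point k (fun S => (wcoef F S ^+ 2)%:E)).
    have FS : L2S F by case/malliavin_domainP: Fd.
    apply: le_lt_trans (ltry (dot P F F)); rewrite (parseval H FS).
    by apply: le_esum => S _; case: ifP => _; rewrite lee_fin ?sqr_ge0.
  have [G [_ [GS Gc _ _]]] := riesz_fischer H cfin.
  exists G, f; split=> //; apply: L2_lim_of_partial => //.
  - by move=> N; case: (derivative_sum_wcoef k N fc).
  - by move=> N S SN; case: (derivative_sum_wcoef k N fc) => _ ->;
    rewrite SN Gc.
  - move=> N S; case: (derivative_sum_wcoef k N fc) => _ ->; rewrite Gc.
    by case: ifP => _; [left|right].
have [f [[fc ffin] lim]] := QD.
split; first by case: lim.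
apply: (wcoef_L2_lim H _ lim).
  by move=> N; case: (derivative_sum_wcoef k N fc).
move=> S; exists #|` S|.+1 => // N /= SN.
by case: (derivative_sum_wcoef k N fc) => _ ->; rewrite SN.
Qed.

End Chaos.

(** * Composition with a Lipschitz function *)

Section ChainRule.
Context {R : realType} {d : measure_display} {T : measurableType d}.
Context {P : probability T R} {p q : nat -> R} {X : nat -> {RV P >-> R}}.
Hypothesis H : rademacher p q X.

Local Notation L2 := (Lfun P 2%:E).
Local Notation Y := (normalised p q X).
Local Notation L2S := (L2_sigma P Y).
Local Notation walsh := (walsh p q X).
Local Notation wcoef := (@wcoef R d T P p q X).
Local Notation bits := (bits X).
Local Notation bit_prod := (bit_prod (Yval p q)).

(** D_k described by its action on coefficients. It makes sense for every
    square-integrable u, in or out of the domain, and is continuous in L2,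
    which allows passing to the limit for a fixed k. *)
Definition is_gradient k (u v : T -> R) : Prop :=
  L2S v /\ forall S, wcoef v S = if k \in S then 0 else wcoef u (k |` S)%fset.

Lemma is_gradient_dot k u v : is_gradient k u v -> ((dot P v v)%:E =
  \esum_(S in [set: {fset nat}])
    (if k \in S then (wcoef u S ^+ 2)%:E else 0))%E.
Proof.
move=> [vS vu]; rewrite (parseval H vS)
  -(esum_add_point k (fun S => (wcoef u S ^+ 2)%:E)).
by apply: eq_esum => S _; rewrite vu; case: ifP; rewrite ?expr0n.
Qed.

(** The coefficients of v are some of those of u, moved. *)
Lemma is_gradient_dot_le k u v : L2S u -> is_gradient k u v ->
  dot P v v <= dot P u u.
Proof.
move=> uS uv; rewrite -lee_fin (is_gradient_dot uv) (parseval H uS).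
by apply: le_esum => S _; case: ifP => _; rewrite lee_fin ?sqr_ge0.
Qed.

Lemma is_gradient_ae k u v v' : is_gradient k u v -> is_gradient k u v' ->
    {ae P, forall w, v w = v' w}.
Proof. by move=> [vS vu] [vS' vu']; apply: (wcoef_ae H) => // S;
  rewrite vu vu'. Qed.

Lemma is_gradientB k u v u' v' :
  L2S u -> L2S u' -> is_gradient k u v -> is_gradient k u' v' ->
  is_gradient k (u \- u') (v \- v').
Proof.
move=> uS uS' [vS vu] [vS' vu']; split; first exact: L2SB.
move=> S; rewrite (wcoefB H _ (L2S_L2 vS) (L2S_L2 vS')) vu vu'.
by case: ifP => _; rewrite ?subrr// (wcoefB H _ (L2S_L2 uS) (L2S_L2 uS')).
Qed.

(** Each S is counted once for every k in S. This is how finiteness of the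
    energy of f(F) follows from pointwise bounds on its derivatives. *)
Lemma energy_gradient (u : T -> R) (v : nat -> T -> R) :
    (forall k, is_gradient k u (v k)) ->
  (energy (P:=P) (p:=p) (q:=q) (X:=X) u =
    \esum_(k in [set: nat]) (dot P (v k) (v k))%:E)%E.
Proof.
move=> uv; under [RHS]eq_esum do rewrite (is_gradient_dot (uv _)).
rewrite esum_exchange; last by move=> k S; case: ifP => // _;
  rewrite lee_fin sqr_ge0.
apply: eq_esum => S _.
rewrite (esumID [set` S]); last by move=> k _; case: ifP => // _;
  rewrite lee_fin sqr_ge0.
rewrite setTI setTI [X in (_ + X)%E]esum1; last first.
  by move=> k /= /negP/negbTE ->.
rewrite adde0 esum_fset//; last by move=> k; case: ifP => // _;
  rewrite lee_fin sqr_ge0.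
rewrite fsbig_finite//= set_fsetK big_seq.
rewrite (eq_bigr (fun=> (wcoef u S ^+ 2)%:E)); last by move=> k ->.
rewrite -big_seq sumEFin; congr EFin.
by rewrite big_const_seq count_predT iter_addr addr0 mulr_natl.
Qed.

Lemma Yval_gap k : Yval p q k true - Yval p q k false = (sqrt_pq p q k)^-1.
Proof. by rewrite /Yval mulNr opprK -mulrDl addrC (pq1 H) mul1r. Qed.

Definition Ybound k : R := `|Yval p q k true| + `|Yval p q k false|.

Lemma Y_bound_ae k : {ae P, forall w, `|Y k w| <= Ybound k}.
Proof.
apply: filterS (Y_bits_ae H) => w ->; rewrite /Ybound.
by case: (bits w k); rewrite ?lerDl ?lerDr.
Qed.

Lemma L2S_mulY k u : L2S u -> L2S (fun w => u w * Y k w).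
Proof.
move=> [mu uL]; have m : measurable_fun [set: g_sigma_algebraType (cylinders Y)]
    (fun w => u w * Y k w).
  by apply: measurable_funM => //; exact: Y_sigma_measurable.
split=> //; apply: (@L2_dom _ _ _ P (Ybound k) _ u) => //.
  exact (g_sigma_measurable_fun (cylinders_measurable (X := X)) m).
by apply: filterS (Y_bound_ae k) => w Yw; rewrite normrM mulrC ler_wpM2r.
Qed.

Section Lipschitz.
Variables (f : R -> R) (K : R).
Hypothesis fK : forall x y, `|f x - f y| <= K * `|x - y|.

Lemma lipschitz_const_ge0 : 0 <= K.
Proof. by have := le_trans (normr_ge0 _) (fK 1 0);
  rewrite subr0 normr1 mulr1. Qed.

Lemma lipschitz_measurable : measurable_fun setT f.
Proof.
apply: continuous_measurable_fun => x; apply/cvgrPdist_lt => e e0.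
have K1 : 0 < K + 1 by rewrite ltr_wpDl// lipschitz_const_ge0.
have := @nbhsx_ballx R R x (e / (K + 1)) (divr_gt0 e0 K1).
apply: filterS => y; rewrite /ball/= => xy.
apply: le_lt_trans (fK x y) _.
apply: (@le_lt_trans _ _ ((K + 1) * `|x - y|));
  first by rewrite ler_wpM2r// lerDl.
by rewrite mulrC -ltr_pdivlMr.
Qed.

Lemma L2S_lipschitz u : L2S u -> L2S (f \o u).
Proof.
move=> [mu uL]; have m : measurable_fun
  [set: g_sigma_algebraType (cylinders Y)] (f \o u).
  by apply: measurableT_comp => //; exact: lipschitz_measurable.
split=> //.
have mT : measurable_fun setT (f \o u).
  exact (g_sigma_measurable_fun (cylinders_measurable (X := X)) m).
have -> : f \o u = (fun w => f (u w) - f 0) \+ cst (f 0).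
  by apply/funext => w /=; rewrite subrK.
apply: L2D; last exact: L2_cst.
apply: (@L2_dom _ _ _ P K _ u) => //; first exact: measurable_funB.
by apply: nearW => w; have := fK (u w) 0; rewrite subr0.
Qed.

(** The derivative of f(A + B Y_k) when A and B do not depend on the sign k. *)
Definition bit_difference k (A B : T -> R) : T -> R := fun w =>
  sqrt_pq p q k * (f (A w + B w * Yval p q k true)
    - f (A w + B w * Yval p q k false)).

Lemma L2S_bit_difference k A B : L2S A -> L2S B -> L2S (bit_difference k A B).
Proof.
move=> AS BS.
have arg b : L2S (fun w => A w + B w * Yval p q k b).
  by apply: L2SD => //; under eq_fun do rewrite mulrC; exact: L2SZ.
apply: L2SZ; apply: L2SB; exact: (L2S_lipschitz (arg _)).
Qed.

(** The two arguments of f differ by B / sqrt(p_k q_k). *)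
Lemma bit_difference_le k A B w : `|bit_difference k A B w| <= K * `|B w|.
Proof.
have s0 := sqrt_pq_gt0 H k.
rewrite /bit_difference normrM (gtr0_norm s0) mulrC -ler_pdivlMr//.
apply: le_trans (fK _ _) _; rewrite opprD addrACA subrr add0r -mulrBr Yval_gap.
by rewrite normrM normfV (gtr0_norm s0) mulrA.
Qed.

Section FiniteBitDifference.
Variables (k M : nat) (al be : (nat -> bool) -> R).
Hypotheses (alM : depends_below M al) (beM : depends_below M be).
Hypotheses (alk : forall e b, al (set_bit e k b) = al e)
  (bek : forall e b, be (set_bit e k b) = be e).

(** Average the right-hand side over the sign k and use p y+ = sqrt(p q) = - q
    y-. *)
Lemma integral_finite_bit_difference S : k \notin S ->
  \int[P]_w (sqrt_pq p q k * (f (al (bits w) + be (bits w) * Yval p q k true) -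
     f (al (bits w) + be (bits w) * Yval p q k false)) * bit_prod S (bits w)) =
  \int[P]_w (f (al (bits w) + be (bits w) * Yval p q k (bits w k))
    * bit_prod (k |` S)%fset (bits w)).
Proof.
move=> kS; have [N SN] := fset_nat_bound (k |` S)%fset.
pose psi e := f (al e + be e * Yval p q k (e k)) * bit_prod (k |` S)%fset e.
have psiM : depends_below (maxn M N) psi.
  move=> e e' ee.
  have eM i : (i < M)%N -> e i = e' i by move=> iM; apply: ee;
    rewrite leq_max iM.
  have eN i : (i < N)%N -> e i = e' i by move=> iN; apply: ee;
    rewrite leq_max iN orbT.
  have ek : e k = e' k by apply: eN; apply: SN; rewrite !inE eqxx.
  rewrite /psi (alM eM) (beM eM) ek; congr (_ * _).
  exact: (@depends_bit_prod _ _ _ _ SN).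
rewrite -[RHS]/(\int[P]_w psi (bits w)) (integral_average_bit H k psiM).
apply: eq_Rintegral => w _; rewrite /average_bit /psi !alk !bek !set_bit_same
  !bit_prod_add//.
rewrite !set_bit_same !bit_prod_set_bit//.
have ps : p k * Yval p q k true = sqrt_pq p q k.
  by rewrite /Yval mulrA -(sqrt_pq_sqr H) expr2 mulfK// gt_eqF//
    (sqrt_pq_gt0 H).
have qs : q k * Yval p q k false = - sqrt_pq p q k.
  by rewrite /Yval mulNr mulrN mulrA [q k * _]mulrC -(sqrt_pq_sqr H) expr2
    mulfK// gt_eqF// (sqrt_pq_gt0 H).
set a := f _; set b := f _; set m := bit_prod S _.
transitivity ((p k * Yval p q k true) * a * m + (q k * Yval p q k false) * b
  * m).
  by rewrite ps qs; ring.
by ring.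
Qed.

(** Nothing but Y_k depends on the sign k, and Y_k is centred. *)
Lemma integral_finite_bit_difference_eq0 S : k \in S ->
  \int[P]_w (sqrt_pq p q k * (f (al (bits w) + be (bits w) * Yval p q k true) -
     f (al (bits w) + be (bits w) * Yval p q k false)) * bit_prod S (bits w)) =
       0.
Proof.
move=> kS; have [N SN] := fset_nat_bound S.
pose psi e := sqrt_pq p q k * (f (al e + be e * Yval p q k true) -
     f (al e + be e * Yval p q k false)) * bit_prod S e.
have psiM : depends_below (maxn M N) psi.
  move=> e e' ee.
  have eM i : (i < M)%N -> e i = e' i by move=> iM; apply: ee;
    rewrite leq_max iM.
  have eN i : (i < N)%N -> e i = e' i by move=> iN; apply: ee;
    rewrite leq_max iN orbT.
  rewrite /psi (alM eM) (beM eM); congr (_ * _).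
  exact: (@depends_bit_prod _ _ _ _ SN).
rewrite -[LHS]/(\int[P]_w psi (bits w)) (integral_average_bit H k psiM).
rewrite (_ : (fun w => _) = cst 0); first by rewrite /Rintegral integral0.
apply/funext => w; rewrite /average_bit /psi !alk !bek !(bit_prod_rem _ _ kS)
  !set_bit_same.
have kSk : k \notin (S `\ k)%fset by rewrite !inE eqxx.
rewrite !bit_prod_set_bit//; set m := bit_prod _ _; set c := sqrt_pq p q k * _.
transitivity ((p k * Yval p q k true + q k * Yval p q k false) * (c * m));
  first by ring.
by rewrite Yval_mean mul0r.
Qed.

End FiniteBitDifference.

End Lipschitz.
End ChainRule.

Arguments Ybound {R} p q k.

Section ChainRuleLimit.
Context {R : realType} {d : measure_display} {T : measurableType d}.
Context {P : probability T R} {p q : nat -> R} {X : nat -> {RV P >-> R}}.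
Hypothesis H : rademacher p q X.

Local Notation L2 := (Lfun P 2%:E).
Local Notation Y := (normalised p q X).
Local Notation L2S := (L2_sigma P Y).
Local Notation walsh := (walsh p q X).
Local Notation walsh_sum := (walsh_sum (p:=p) (q:=q) (X:=X)).
Local Notation wcoef := (@wcoef R d T P p q X).
Local Notation bits := (bits X).
Local Notation bit_prod := (bit_prod (Yval p q)).
Local Notation is_gradient := (@is_gradient R d T P p q X).
Local Notation bit_difference := (@bit_difference R d T p q).

Lemma dot_bits M g u v : u \in L2 -> v \in L2 -> depends_below M g ->
  {ae P, forall w, u w * v w = g (bits w)} -> dot P u v = \int[P]_w g (bits w).
Proof.
move=> uL vL gM uv.
have -> : \int[P]_w g (bits w) = dot P (fun w => g (bits w)) (cst 1).
  by apply: eq_Rintegral => w _; rewrite mulr1.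
apply: dot_ae => //; [exact: depends_bits_L2 gM|exact: L2_cst|].
by apply: filterS uv => w ->; rewrite mulr1.
Qed.

Section Split.
Variables (k : nat) (A : {fset {fset nat}}) (a : {fset nat} -> R).

Definition free_part (w : T) : R := \sum_(S <- A | k \notin S) a S * walsh S w.
Definition slope_part (w : T) : R :=
  \sum_(S <- A | k \in S) a S * walsh (S `\ k)%fset w.
Definition free_bits (e : nat -> bool) : R :=
  \sum_(S <- A | k \notin S) a S * bit_prod S e.
Definition slope_bits (e : nat -> bool) : R :=
    \sum_(S <- A | k \in S) a S * bit_prod (S `\ k)%fset e.

(** The decomposition A + B Y_k of a finite Walsh sum. *)
Lemma walsh_sum_split w : walsh_sum A a w = free_part w + slope_part w * Y k w.
Proof.
rewrite /walsh_sum (bigID (fun S => k \in S))/= addrC; congr (_ + _).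
rewrite /slope_part mulr_suml; apply: eq_bigr => S kS.
by rewrite -mulrA; congr (_ * _); rewrite /walsh (big_fsetD1 k)//= mulrC.
Qed.

Lemma L2S_free_part : L2S free_part.
Proof. by apply: L2S_sum => S _; apply: L2SZ; exact (L2S_walsh H S). Qed.

Lemma L2S_slope_part : L2S slope_part.
Proof. by apply: L2S_sum => S _; apply: L2SZ; exact (L2S_walsh H _). Qed.

Lemma slope_part_is_gradient : is_gradient k (walsh_sum A a) slope_part.
Proof.
split; first exact: L2S_slope_part.
move=> S'; rewrite /slope_part (wcoef_sum H); last first.
  by move=> S _; apply: L2Z; exact (walsh_L2 H _).
rewrite (eq_bigr (fun S => a S * (S `\ k == S')%fset%:R)) => [|S _]; last first.
  by rewrite (wcoefZ H) ?(wcoef_walsh H)//; exact (walsh_L2 H _).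
case: ifPn => kS'.
  rewrite big1// => S _; case: eqP => [e|_]; last by rewrite mulr0.
  by move: kS'; rewrite -e !inE eqxx.
rewrite /walsh_sum (wcoef_sum H); last first.
  by move=> S _; apply: L2Z; exact (walsh_L2 H _).
rewrite big_mkcond; apply: eq_bigr => S _.
rewrite (wcoefZ H) ?(wcoef_walsh H)//; last exact (walsh_L2 H _).
case: ifPn => kS.
  congr (_ * _%:R); congr nat_of_bool; apply/eqP/eqP => [<-|->].
    by rewrite fsetD1K.
  by rewrite fsetU1K.
case: eqP => [e|_]; last by rewrite mulr0.
by move: kS; rewrite e !inE eqxx.
Qed.

Lemma part_bits_ae :
  {ae P, forall w, free_part w = free_bits (bits w) /\
    slope_part w = slope_bits (bits w)}.
Proof.
apply: filterS (walsh_bits H) => w Ww.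
by split; apply: eq_bigr => S _; rewrite Ww.
Qed.

Lemma bit_depends : exists M,
  depends_below M free_bits /\ depends_below M slope_bits.
Proof.
have [M hM] := fset_nat_bound (\bigcup_(S <- A) S)%fset.
have SM S i : S \in A -> i \in S -> (i < M)%N.
  by move=> SA iS; apply: hM; apply/bigfcupP; exists S => //; rewrite SA.
exists M; split=> e e' ee; rewrite /free_bits /slope_bits big_seq_cond
  [RHS]big_seq_cond;
  apply: eq_bigr => S /andP[SA _]; congr (_ * _).
  by apply: (@depends_bit_prod _ _ _ M) => // i; exact: SM.
by apply: (@depends_bit_prod _ _ _ M) => // i; rewrite !inE => /andP[_];
  exact: SM.
Qed.

Lemma free_bits_set_bit e b : free_bits (set_bit e k b) = free_bits e.
Proof. by apply: eq_bigr => S kS; rewrite bit_prod_set_bit. Qed.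

Lemma slope_bits_set_bit e b : slope_bits (set_bit e k b) = slope_bits e.
Proof. by apply: eq_bigr => S kS; rewrite bit_prod_set_bit// !inE eqxx. Qed.

Variables (f : R -> R) (K : R).
Hypothesis fK : forall x y, `|f x - f y| <= K * `|x - y|.

(** Both coefficients to be compared are integrals of functions of finitely
    many signs, for which the averaging identities hold. *)
Lemma finite_bit_difference_is_gradient : is_gradient k (f \o walsh_sum A a)
    (bit_difference f k free_part slope_part).
Proof.
have [M [AM BM]] := bit_depends.
have cS : L2S (bit_difference f k free_part slope_part).
  by apply: (L2S_bit_difference fK);
    [exact: L2S_free_part|exact: L2S_slope_part].
have fS : L2S (f \o walsh_sum A a).
  by apply: (L2S_lipschitz fK); exact (L2S_walsh_sum H A a).
split=> // S; have [N SN] := fset_nat_bound (k |` S)%fset.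
pose g e := sqrt_pq p q k * (f (free_bits e + slope_bits e * Yval p q k true) -
     f (free_bits e + slope_bits e * Yval p q k false)) * bit_prod S e.
have ext e e' : (forall i, (i < maxn M N)%N -> e i = e' i) ->
    (forall i, (i < M)%N -> e i = e' i) /\ (forall i, (i < N)%N -> e i = e' i).
  by move=> ee; split=> i iM; apply: ee; rewrite leq_max iM ?orbT.
have gM : depends_below (maxn M N) g.
  move=> e e' /ext[eM eN]; rewrite /g (AM _ _ eM) (BM _ _ eM); congr (_ * _).
  apply: (@depends_bit_prod _ _ _ N) => // i iS; apply: SN;
    by rewrite inE iS orbT.
have -> : wcoef (bit_difference f k free_part slope_part) S =
  \int[P]_w g (bits w).
  apply: (dot_bits (L2S_L2 cS) (walsh_L2 H S) gM).
  apply: filterS2 part_bits_ae (walsh_bits H) => w [Aw Bw] Ww.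
  by rewrite /bit_difference Aw Bw Ww.
case: ifPn => kS.
  exact: (integral_finite_bit_difference_eq0 H f AM BM free_bits_set_bit
    slope_bits_set_bit kS).
rewrite (integral_finite_bit_difference H f AM BM free_bits_set_bit
  slope_bits_set_bit kS).
pose h e := f (free_bits e + slope_bits e * Yval p q k (e k)) * bit_prod
  (k |` S)%fset e.
have hM : depends_below (maxn M N) h.
  move=> e e' /ext[eM eN]; rewrite /h (AM _ _ eM) (BM _ _ eM).
  rewrite (eN k); last by apply: SN; rewrite !inE eqxx.
  by congr (_ * _); apply: (@depends_bit_prod _ _ _ N).
apply/esym; apply: (dot_bits (L2S_L2 fS) (walsh_L2 H _) hM).
apply: filterS3 part_bits_ae (walsh_bits H) (Y_bits_ae H) => w [Aw Bw] Ww Yw.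
by rewrite /= walsh_sum_split Aw Bw Ww Yw.
Qed.

End Split.

Section L2Null.

Definition L2_null (u : nat -> T -> R) : Prop :=
  (forall n, u n \in L2) /\ dot P (u n) (u n) @[n --> \oo] --> (0 : R).

Lemma L2_null_dom (c : R) u v : 0 <= c -> (forall n, v n \in L2) -> L2_null u ->
  (forall n, {ae P, forall w, `|v n w| <= c * `|u n w|}) -> L2_null v.
Proof.
move=> c0 vL [uL u0] vu; split=> //.
have h : c ^+ 2 * dot P (u n) (u n) @[n --> \oo] --> (0 : R).
  by rewrite -[X in _ --> X](mulr0 (c ^+ 2)); apply: cvgM => //; exact: cvg_cst.
apply: (squeeze_cvgr _ (cvg_cst 0) h); apply: nearW => n.
by rewrite dot_ge0/=; apply: dot_le.
Qed.

Lemma L2_nullD u v : L2_null u -> L2_null v -> L2_null (fun n => u n \+ v n).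
Proof.
move=> [uL u0] [vL v0]; split=> [n|]; first exact: L2D.
have h : 2 * (dot P (u n) (u n) + dot P (v n) (v n)) @[n --> \oo] --> (0 : R).
  rewrite (_ : (0 : R) = 2 * (0 + 0)); last by rewrite addr0 mulr0.
  by apply: cvgM; [exact: cvg_cst|exact: cvgD].
apply: (squeeze_cvgr _ (cvg_cst 0) h); apply: nearW => n.
by rewrite dot_ge0/=; apply: dotD_le.
Qed.

End L2Null.

Section Limit.
Variables (f : R -> R) (K : R).
Hypothesis fK : forall x y, `|f x - f y| <= K * `|x - y|.

Lemma L2_null_lipschitz (u : nat -> T -> R) v :
  (forall n, L2S (u n)) -> L2S v ->
  L2_null (fun n => u n \- v) -> L2_null (fun n => (f \o u n) \- (f \o v)).
Proof.
move=> uS vS uv; apply: (L2_null_dom (lipschitz_const_ge0 fK) _ uv).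
  by move=> n; exact (L2B (L2S_L2 (L2S_lipschitz fK (uS n)))
    (L2S_L2 (L2S_lipschitz fK vS))).
by move=> n; apply: nearW => w; exact: fK.
Qed.

(** Approximate F by finite Walsh sums F_n = A_n + B_n Y_k. Since B_n is the
    gradient of F_n, B_n - B is dominated in norm by F_n - F, so B_n tends to B
    and A_n = F_n - B_n Y_k tends to F - B Y_k; the Lipschitz property carries
    the formula to the limit, coefficient by coefficient. *)
Lemma bit_difference_is_gradient k F B : L2S F -> is_gradient k F B ->
  is_gradient k (f \o F) (bit_difference f k (fun w => F w - B w * Y k w) B).
Proof.
move=> FS FB; have BS := FB.1.
pose A w := F w - B w * Y k w.
have AS : L2S A by apply: L2SB => //; exact: L2S_mulY.
have Ffin : (\esum_(S in [set: {fset nat}]) (wcoef F S ^+ 2)%:E < +oo)%E.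
  by rewrite -(parseval H FS) ltry.
have [G [C [GS Gc _ Gcvg]]] := riesz_fischer H Ffin.
pose a := wcoef F; pose Fn n := walsh_sum (C n) a.
pose An n := free_part k (C n) a; pose Bn n := slope_part k (C n) a.
have FnS n : L2S (Fn n) by exact (L2S_walsh_sum H (C n) a).
have AnS n : L2S (An n) by exact: L2S_free_part.
have BnS n : L2S (Bn n) by exact: L2S_slope_part.
have FG : {ae P, forall w, F w = G w}.
  by apply: (wcoef_ae H) => // S; rewrite Gc.
have Fnull : L2_null (fun n => Fn n \- F).
  apply: (@L2_null_dom 1 (fun n => Fn n \- G)) => // [n|| n].
  - exact: L2B (L2S_L2 (FnS n)) (L2S_L2 FS).
  - by split=> // n; exact: L2B (L2S_L2 (FnS n)) (L2S_L2 GS).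
  - by apply: filterS FG => w Fw; rewrite /= Fw mul1r.
have BnD n : is_gradient k (Fn n \- F) (Bn n \- B).
  by apply: is_gradientB => //; exact: slope_part_is_gradient.
have Bnull : L2_null (fun n => Bn n \- B).
  split=> [n|]; first exact: L2B (L2S_L2 (BnS n)) (L2S_L2 BS).
  apply: (squeeze_cvgr _ (cvg_cst 0) Fnull.2); apply: nearW => n.
  by rewrite dot_ge0/=; apply: (is_gradient_dot_le H _ (BnD n)); exact: L2SB.
(* An n - A = (Fn n - F) - (Bn n - B) Y_k, and Y_k is bounded. *)
have Anull : L2_null (fun n => An n \- A).
  have BY : L2_null (fun n w => (Bn n w - B w) * Y k w).
    apply: (@L2_null_dom (Ybound p q k) _ _ _ _ Bnull).
    - by rewrite addr_ge0.
    - by move=> n; apply: L2S_L2; apply: (L2S_mulY H); exact: L2SB.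
    - by move=> n; apply: filterS (Y_bound_ae H k) => w Yw;
      rewrite normrM mulrC ler_wpM2r.
  have NBY : L2_null (fun n w => - ((Bn n w - B w) * Y k w)).
    apply: (@L2_null_dom 1 _ _ _ _ BY) => // n.
      have [BYL _] := BY; rewrite (_ : (fun w => - _) =
        (fun w => -1 * ((Bn n w - B w) * Y k w))).
        by apply: L2Z; exact: BYL.
      by apply/funext => w; rewrite mulN1r.
    by apply: nearW => w; rewrite normrN mul1r.
  have := L2_nullD Fnull NBY; congr L2_null; apply/funext => n;
    apply/funext => w /=.
  by rewrite /A /Fn (walsh_sum_split k) -/(An n w) -/(Bn n w); ring.
have argS (A' B' : T -> R) b : L2S A' -> L2S B' ->
  L2S (fun w => A' w + B' w * Yval p q k b).
  by move=> ? ?; apply: L2SD => //; under eq_fun do rewrite mulrC; exact: L2SZ.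
have argnull b : L2_null (fun n =>
    (fun w => An n w + Bn n w * Yval p q k b) \- (fun w =>
      A w + B w * Yval p q k b)).
  have BY : L2_null (fun n w => (Bn n w - B w) * Yval p q k b).
    apply: (@L2_null_dom `|Yval p q k b| _ _ _ _ Bnull) => // n.
      apply: L2S_L2; under eq_fun do rewrite mulrC.
      by apply: L2SZ; exact: L2SB.
    by apply: nearW => w; rewrite normrM mulrC.
  have := L2_nullD Anull BY; congr L2_null; apply/funext => n;
    apply/funext => w /=.
  by ring.
have chainS : L2S (bit_difference f k A B) by exact: (L2S_bit_difference fK).
have chainnS n : L2S (bit_difference f k (An n) (Bn n))
  by exact: (L2S_bit_difference fK).
have chainnull : L2_null (fun n => bit_difference f k (An n) (Bn n) \-
  bit_difference f k A B).
  have h b := L2_null_lipschitz (fun n => argS _ _ b (AnS n) (BnS n))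
    (argS _ _ b AS BS) (argnull b).
  pose s := sqrt_pq p q k.
  have hs b (c : R) : L2_null (fun n w =>
    c * (f (An n w + Bn n w * Yval p q k b) - f (A w + B w * Yval p q k b))).
    apply: (@L2_null_dom `|c| _ _ _ _ (h b)) => // n.
      by have [hL _] := h b; exact (L2Z c (hL n)).
    by apply: nearW => w; rewrite normrM.
  have := L2_nullD (hs true s) (hs false (- s)).
  congr L2_null; apply/funext => n; apply/funext => w /=.
  by rewrite /bit_difference /s; ring.
have fnull := L2_null_lipschitz FnS FS Fnull.
split=> // S.
have c1 : wcoef (bit_difference f k (An n) (Bn n)) S @[n --> \oo] -->
  wcoef (bit_difference f k A B) S.
  by apply: dot_cvgl chainnull.2 => // [n||];
    [exact (L2S_L2 (chainnS n))|exact (L2S_L2 chainS)|exact (walsh_L2 H S)].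
have c2 S' : wcoef (f \o Fn n) S' @[n --> \oo] --> wcoef (f \o F) S'.
  apply: dot_cvgl fnull.2 => // [n||];
    [|exact (L2S_L2 (L2S_lipschitz fK FS))|exact (walsh_L2 H S')].
  exact (L2S_L2 (L2S_lipschitz fK (FnS n))).
have fin n := (finite_bit_difference_is_gradient k (C n) a fK).2 S.
case: ifPn fin => kS fin.
  have c3 : wcoef (bit_difference f k (An n) (Bn n)) S @[n --> \oo] --> (0 : R).
    rewrite (_ : (fun n => _) = cst 0); first exact: cvg_cst.
    by apply/funext => n; rewrite fin.
  exact (cvg_unique (@Rhausdorff R) c1 c3).
have c3 : wcoef (bit_difference f k (An n) (Bn n)) S @[n --> \oo] -->
  wcoef (f \o F) (k |` S)%fset.
  rewrite (_ : (fun n => _) = (fun n => wcoef (f \o Fn n) (k |` S)%fset));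
    first exact: c2.
  by apply/funext => n; rewrite fin.
exact (cvg_unique (@Rhausdorff R) c1 c3).
Qed.

(** The formula for the derivative of f(F) bounds it by K |D_k F|, and the sum
    over k of the squared norms is the energy. *)
Lemma lipschitz_malliavin_domain F : malliavin_domain P Y F ->
  malliavin_domain P Y (f \o F).
Proof.
move=> Fd; have [FS Ffin] := (malliavin_domainP H F).1 Fd.
pose v k := D P Y k F.
have vD k : is_gradient k F (v k) by exact (D_wcoef H k Fd).
have cD k := bit_difference_is_gradient FS (vD k).
apply/(malliavin_domainP H); split; first exact: (L2S_lipschitz fK).
rewrite (energy_gradient H cD).
(* K may be 0, while the rescaling of sums needs a positive factor. *)
have K1 : 0 < K + 1 by rewrite ltr_wpDl// (lipschitz_const_ge0 fK).
apply: (@le_lt_trans _ _ (\esum_(k in [set: nat])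
  (((K + 1) ^+ 2)%:E * (dot P (v k) (v k))%:E))%E).
  apply: le_esum => k _; rewrite -EFinM lee_fin.
  apply: dot_le; [exact: ltW|exact: L2S_L2 (cD k).1|exact: L2S_L2 (vD k).1|].
  apply: nearW => w; apply: le_trans (bit_difference_le H fK k _ _ w) _.
  by rewrite ler_wpM2r// lerDl.
rewrite esumZl ?exprn_gt0//; last by move=> k; rewrite lee_fin dot_ge0.
by rewrite -(energy_gradient H vD) lte_mul_pinfty// lee_fin exprn_ge0// ltW.
Qed.

Lemma D_lipschitz_ae k F : malliavin_domain P Y F ->
  {ae P, forall w, D P Y k (f \o F) w =
     bit_difference f k (fun w => F w - D P Y k F w * Y k w) (D P Y k F) w}.
Proof.
move=> Fd; have [FS _] := (malliavin_domainP H F).1 Fd.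
apply: (is_gradient_ae H);
  first exact: (D_wcoef H k (lipschitz_malliavin_domain Fd)).
by apply: bit_difference_is_gradient => //; exact (D_wcoef H k Fd).
Qed.

End Limit.
End ChainRuleLimit.

(** * The chain rule *)

Theorem lemma2p2 (R : realType) (d : measure_display) (T : measurableType d)
    (P : probability T R) (p q : nat -> R) (X : nat -> {RV P >-> R})
    (hp : forall k, 0 < p k < 1) (hq : forall k, q k = 1 - p k)
    (hX1 : forall k, P [set w | X k w = 1] = (p k)%:E)
    (hXN1 : forall k, P [set w | X k w = -1] = (q k)%:E)
    (hind : mutually_independent X)
    (F : T -> R) (hF : malliavin_domain P (normalised p q X) F)
    (f : R -> R) (f_lip : lipschitz f)
    (f_der : forall x : R, derivable f x 1) (f'_cont : continuous (derive1 f))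
    (f'_lip : lipschitz (derive1 f)) (k : nat) :
  exists Rk : {RV P >-> R},
    {ae P, forall w,
       D P (normalised p q X) k (f \o F) w =
       derive1 f (F w) * D P (normalised p q X) k F w + Rk w} /\
    {ae P, forall w,
       (`|Rk w|%:E <=
          second_derivative_norm f * ((2 * Num.sqrt (p k * q k))^-1)%:E
            * (`|D P (normalised p q X) k F w| ^+ 2)%:E)%E}.
Proof.
have H : rademacher p q X by [].
have [K _ fK] := lipschitz_constant f_lip.
have [K' _ f'K] := lipschitz_constant f'_lip.
have fFd := lipschitz_malliavin_domain H fK hF.
have [[mD _] _] := D_wcoef H k hF.
have [[mDf _] _] := D_wcoef H k fFd.
have [[mF FL] _] := (malliavin_domainP H F).1 hF.
pose DF := D P (normalised p q X) k F;
  pose Df := D P (normalised p q X) k (f \o F).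
pose r w := Df w - derive1 f (F w) * DF w.
have toT u : measurable_fun [set: g_sigma_algebraType
  (cylinders (normalised p q X))] u ->
    measurable_fun [set: T] (u : T -> R).
  by move=> mu; exact (g_sigma_measurable_fun (cylinders_measurable (X := X))
    mu).
have mr : measurable_fun [set: T] r.
  apply: measurable_funB; first exact: toT.
  apply: measurable_funM; last exact: toT.
  by apply: measurableT_comp; [exact: lipschitz_measurable f'K|exact: toT].
pose Rk := HB.pack_for {RV P >-> R} r (isMeasurableFun.Build _ _ _ _ r mr).
exists Rk; split.
  by apply: nearW => w; rewrite /Rk /= /r addrC subrK.
apply: filterS2 (D_lipschitz_ae H fK k hF) (Y_bits_ae H) => w Dw Yw.
have s0 := sqrt_pq_gt0 H k; rewrite -/(sqrt_pq p q k).
set s := sqrt_pq p q k in s0 *; rewrite -/DF -/Df in Dw *.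
(* y is the value F would take if the sign k were flipped. *)
have key y : (y - F w) ^+ 2 = (DF w / s) ^+ 2 ->
    `|r w| = s * `|f y - f (F w) - derive1 f (F w) * (y - F w)| ->
    (`|r w|%:E <= second_derivative_norm f * ((2 * s)^-1)%:E
      * (`|DF w| ^+ 2)%:E)%E.
  move=> y2 ->; rewrite EFinM.
  apply: le_trans (lee_wpmul2l _ (second_derivative_remainder f_der f'_lip
    (F w) y)) _.
    by rewrite lee_fin ltW.
  rewrite muleCA -muleA le_eqVlt; apply/orP; left; apply/eqP.
  congr (_ * _)%E; rewrite -!EFinM; congr EFin.
  by rewrite y2 real_normK ?num_real//; field; rewrite gt_eqF.
have gap := Yval_gap H k; rewrite -/s in gap.
have lo : Yval p q k false = Yval p q k true - s^-1 by rewrite -gap; ring.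
(* If the sign k is 1 at w, the point of the pair lying at F w is the first
   one; otherwise it is the second, and no change of sign is needed. *)
move: Dw; rewrite /bit_difference -/s Yw; case: (bits X w k);
  rewrite subrK => Dw.
  apply: (key (F w - DF w / s)); first by ring.
  rewrite -[X in _ = X * _](gtr0_norm s0) -normrM -[RHS]normrN; congr `|_|.
  rewrite /r Dw (_ : F w - _ + _ = F w - DF w / s); last by rewrite lo; ring.
  by field; rewrite gt_eqF.
apply: (key (F w + DF w / s)); first by ring.
rewrite -[X in _ = X * _](gtr0_norm s0) -normrM; congr `|_|.
rewrite /r Dw (_ : F w - _ + _ = F w + DF w / s); last by rewrite lo; ring.
by field; rewrite gt_eqF.
Qed.
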